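(* Let $R$ be an arbitrary ring. For any finitely presented functor $F\in\mathrm{fp}(R\text{-}\mathrm{Mod},\mathrm{Ab})$, its $0$-th right pure-derived functor $\widetilde{R}^0F:R\text{-}\mathrm{Mod}\to\mathrm{Ab}$ is also finitely presented, i.e. $\widetilde{R}^0F\in\mathrm{fp}(R\text{-}\mathrm{Mod},\mathrm{Ab})$.
   Context: All categories and functors are additive. $R\text{-}\mathrm{Mod}$ is the category of left $R$-modules (all of them, not only finitely presented ones) and $(X,-)$ denotes the representable (Hom) functor. $\mathrm{fp}(R\text{-}\mathrm{Mod},\mathrm{Ab})$ is the category of finitely presented functors, i.e. additive functors $F:R\text{-}\mathrm{Mod}\to\mathrm{Ab}$ for which there is an exact sequence of functors $(Y,-)\to(X,-)\to F\to0$ with $X,Y\in R\text{-}\mathrm{Mod}$. A short exact sequence of left $R$-modules is pure-exact if it stays exact after tensoring with every finitely presented right $R$-module; a module $U$ is pure-injective if $(-,U)$ sends pure-exact sequences to exact sequences. A pure-injective copresentation of a left $R$-module $M$ is an injective copresentation with respect to the pure-exact structure on $R\text{-}\mathrm{Mod}$: a sequence $0\to M\to U\to V$ with $U,V$ pure-injective which is exact and remains exact after tensoring with every finitely presented right $R$-module, with $M\to U$ a pure monomorphism and the induced map $U/M\to V$ a pure monomorphism. The $0$-th right pure-derived functor $\widetilde{R}^0F$ of $F$ is the $0$-th right derived functor of $F$ with respect to the pure-exact structure: for each $M$ and each pure-injective copresentation $0\to M\to U\to V$, the sequence $0\to(\widetilde{R}^0F)M\to FU\to FV$ is exact, i.e.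 $(\widetilde{R}^0F)M=\mathrm{Ker}(FU\to FV)$ (well defined and functorial up to isomorphism). *)

(* Defs.v *)
From HB Require Import structures.
From mathcomp Require Import all_boot all_algebra generic_quotient ring_quotient.
From mathcomp Require Import boolp freeg.

Set Implicit Arguments.
Unset Strict Implicit.
Unset Printing Implicit Defensive.

Import GRing.Theory.
Local Open Scope ring_scope.
Local Open Scope quotient_scope.

(* Left R-modules are lmodType R, right R-modules are lmodType R^c (the scalar
   action r *: x of R^c is the right action x.r), and abelian groups are
   zmodType.  The ring R is unital and associative, possibly zero. *)

Section Exactness.

Definition exact_at (A B C : zmodType) (f : A -> B) (g : B -> C) : Prop :=
  forall b, g b = 0 <-> exists a, f a = b.

Definition surj (A B : Type) (f : A -> B) : Prop := forall b, exists a, f a = b.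

(* 0 -> A -> B -> C *)
Definition left_exact_seq (A B C : zmodType) (f : A -> B) (g : B -> C) : Prop :=
  injective f /\ exact_at f g.

(* 0 -> A -> B -> C -> 0 *)
Definition short_exact (A B C : zmodType) (f : A -> B) (g : B -> C) : Prop :=
  [/\ injective f, exact_at f g & surj g].

End Exactness.

Section HomGroup.
Variables (R : pzRingType) (X Y : lmodType R).
Implicit Types f g h : {linear X -> Y}.

HB.instance Definition _ := gen_eqMixin {linear X -> Y}.
HB.instance Definition _ := gen_choiceMixin {linear X -> Y}.

Lemma linear_ext f g : f =1 g -> f = g.
Proof.
case: f g => [f [[cf] [df]]] [g [[cg] [dg]]] /= /funext efg.
move: cf df cg dg; rewrite -efg => cf df cg dg.
by rewrite (Prop_irrelevance cf cg) (Prop_irrelevance df dg).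
Qed.

Definition hom_zero : {linear X -> Y} := \0.
Definition hom_opp f : {linear X -> Y} := \- f.
Definition hom_add f g : {linear X -> Y} := f \+ g.

Lemma hom_addA : associative hom_add.
Proof. by move=> f g h; apply: linear_ext => x /=; rewrite addrA. Qed.

Lemma hom_addC : commutative hom_add.
Proof. by move=> f g; apply: linear_ext => x /=; rewrite addrC. Qed.

Lemma hom_add0 : left_id hom_zero hom_add.
Proof. by move=> f; apply: linear_ext => x /=; rewrite add0r. Qed.

Lemma hom_addN : left_inverse hom_zero hom_opp hom_add.
Proof. by move=> f; apply: linear_ext => x /=; rewrite addNr. Qed.

HB.instance Definition _ := GRing.isZmodule.Build {linear X -> Y}
  hom_addA hom_addC hom_add0 hom_addN.

End HomGroup.

Definition comp_lin (R : pzRingType) (X Y Z : lmodType R)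
  (g : {linear Y -> Z}) (f : {linear X -> Y}) : {linear X -> Z} := g \o f.

Definition id_lin (R : pzRingType) (X : lmodType R) : {linear X -> X} := idfun.

Section Functors.
Variable R : pzRingType.

Record functor := Functor {
  fobj :> lmodType R -> zmodType;
  fmap : forall X Y : lmodType R, {linear X -> Y} -> {additive fobj X -> fobj Y};
  fmap_id : forall X : lmodType R, fmap (id_lin X) =1 id;
  fmap_comp : forall (X Y Z : lmodType R)
    (g : {linear Y -> Z}) (f : {linear X -> Y}),
    fmap (comp_lin g f) =1 fmap g \o fmap f;
  fmap_add : forall (X Y : lmodType R) (f g : {linear X -> Y}),
    fmap (f + g) =1 fmap f \+ fmap g
}.

Record nat_trans (F G : functor) := NatTrans {
  component :> forall Z : lmodType R, {additive F Z -> G Z};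
  naturality : forall (Y Z : lmodType R) (f : {linear Y -> Z}),
    component Z \o fmap F f =1 fmap G f \o component Y
}.

Section Postcomposition.
Variables (X Y Z : lmodType R) (f : {linear Y -> Z}).

Definition postcomp (h : {linear X -> Y}) : {linear X -> Z} := comp_lin f h.

Lemma postcomp_is_zmod_morphism : zmod_morphism postcomp.
Proof. by move=> h k; apply: linear_ext => x /=; rewrite raddfB. Qed.

HB.instance Definition _ :=
  GRing.isZmodMorphism.Build {linear X -> Y} {linear X -> Z} postcomp
    postcomp_is_zmod_morphism.

End Postcomposition.

Section Representable.
Variable X : lmodType R.

Definition hom_obj (Z : lmodType R) : zmodType := {linear X -> Z}.

Definition hom_map (Y Z : lmodType R) (f : {linear Y -> Z}) :
  {additive hom_obj Y -> hom_obj Z} := @postcomp X Y Z f.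

Lemma hom_map_id (Y : lmodType R) : hom_map (id_lin Y) =1 id.
Proof. by move=> h; apply: linear_ext. Qed.

Lemma hom_map_comp (Y Z W : lmodType R)
  (g : {linear Z -> W}) (f : {linear Y -> Z}) :
  hom_map (comp_lin g f) =1 hom_map g \o hom_map f.
Proof. by move=> h; apply: linear_ext. Qed.

Lemma hom_map_add (Y Z : lmodType R) (f g : {linear Y -> Z}) :
  hom_map (f + g) =1 hom_map f \+ hom_map g.
Proof. by move=> h; apply: linear_ext. Qed.

(* The representable functor (X, -). *)
Definition hom_functor : functor :=
  Functor hom_map_id hom_map_comp hom_map_add.

End Representable.

Definition finitely_presented (F : functor) : Prop :=
  exists (X Y : lmodType R)
    (a : nat_trans (hom_functor Y) (hom_functor X))
    (b : nat_trans (hom_functor X) F),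
    forall Z : lmodType R, exact_at (a Z) (b Z) /\ surj (b Z).

End Functors.

Section Tensor.
Variables (R : pzRingType) (N : lmodType R^c) (M : lmodType R).

Definition tensor_free : zmodType := {freeg (N * M) / int}.

Definition free_tens (x : N) (m : M) : tensor_free := << (x, m) >>.

(* The last relation is xr (x) m = x (x) rm. *)
Definition contains_tensor_relations (S : {pred tensor_free}) : Prop :=
  [/\ forall x y m, free_tens (x + y) m - free_tens x m - free_tens y m \in S,
      forall x m n, free_tens x (m + n) - free_tens x m - free_tens x n \in S
    & forall (r : R) x m,
        free_tens ((r : R^c) *: x) m - free_tens x (r *: m) \in S].

(* The subgroup generated by the bilinearity relations. *)
Definition tensor_relations : {pred tensor_free} := fun t =>
  `[< forall S : {pred tensor_free},
        zmod_closed S -> contains_tensor_relations S -> t \in S >].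

Lemma tensor_relationsP t : reflect
  (forall S : {pred tensor_free},
     zmod_closed S -> contains_tensor_relations S -> t \in S)
  (t \in tensor_relations).
Proof. exact: asboolP. Qed.

Lemma tensor_relations_zmod_closed : zmod_closed tensor_relations.
Proof.
split=> [|s t /tensor_relationsP sP /tensor_relationsP tP].
  by apply/tensor_relationsP => S [].
apply/tensor_relationsP => S cS rS.
by case: (cS) => _; apply; [apply: sP | apply: tP].
Qed.

HB.instance Definition _ :=
  GRing.isZmodClosed.Build tensor_free tensor_relations
    tensor_relations_zmod_closed.

Lemma tensor_relations_contains : contains_tensor_relations tensor_relations.
Proof.
by split=> *; apply/tensor_relationsP => S _ [r1 r2 r3];
  [apply: r1 | apply: r2 | apply: r3].
Qed.

(* The abelian group N (x)_R M. *)
Definition tensor : zmodType := Quotient.quot tensor_relations.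

Definition tens (x : N) (m : M) : tensor := \pi_tensor (free_tens x m).

End Tensor.

Arguments tensor_relations {R} N M _.

Section TensorMap.
Variables (R : pzRingType) (N : lmodType R^c) (A B : lmodType R).
Variable f : {linear A -> B}.

Definition free_tensor_map : tensor_free N A -> tensor_free N B :=
  fglift (fun p : N * A => free_tens p.1 (f p.2)).

Lemma free_tensor_map_is_zmod_morphism : zmod_morphism free_tensor_map.
Proof. exact: lift_is_additive. Qed.

HB.instance Definition _ :=
  GRing.isZmodMorphism.Build (tensor_free N A) (tensor_free N B)
    free_tensor_map free_tensor_map_is_zmod_morphism.

Lemma free_tensor_map_tens x m :
  free_tensor_map (free_tens x m) = free_tens x (f m).
Proof. by rewrite /free_tensor_map /free_tens liftU scale1r. Qed.

Lemma free_tensor_map_relations t :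
  t \in tensor_relations N A -> free_tensor_map t \in tensor_relations N B.
Proof.
move=> /tensor_relationsP/(_ [pred s | free_tensor_map s \in tensor_relations N B]).
have [r1 r2 r3] := tensor_relations_contains N B.
rewrite inE; apply.
  split=> [|s u]; rewrite !inE; first by rewrite raddf0 rpred0.
  by move=> sr ur; rewrite raddfB rpredB.
split=> *; rewrite inE !raddfB /= !free_tensor_map_tens; first exact: r1.
  by rewrite raddfD; apply: r2.
by rewrite linearZ; apply: r3.
Qed.

(* The homomorphism 1_N (x) f. *)
Definition tensor_map (t : tensor N A) : tensor N B :=
  \pi_(tensor N B) (free_tensor_map (repr t)).

Lemma tensor_map_pi t :
  tensor_map (\pi_(tensor N A) t) = \pi_(tensor N B) (free_tensor_map t).
Proof.
apply/eqP; rewrite -[_ == _]/(_ == _ %[mod Quotient.quot _]) -Quotient.idealrBE.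
rewrite -raddfB; apply: free_tensor_map_relations.
by rewrite Quotient.idealrBE reprK.
Qed.

Lemma tensor_map_is_zmod_morphism : zmod_morphism tensor_map.
Proof.
elim/quotW=> s; elim/quotW=> t.
by rewrite -raddfB !tensor_map_pi !raddfB.
Qed.

HB.instance Definition _ :=
  GRing.isZmodMorphism.Build (tensor N A) (tensor N B)
    tensor_map tensor_map_is_zmod_morphism.

Lemma tensor_map_tens x m : tensor_map (tens x m) = tens x (f m).
Proof. by rewrite tensor_map_pi free_tensor_map_tens. Qed.

End TensorMap.

Arguments tensor_map {R} N {A B} f t.

Section Purity.
Variable R : pzRingType.

(* R^m -> R^n -> N -> 0 is exact; row vectors over R^c are the free right
   R-modules of finite rank. *)
Definition fp_right_module (N : lmodType R^c) : Prop :=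
  exists (m n : nat) (a : {linear 'rV[R^c]_m -> 'rV[R^c]_n})
    (b : {linear 'rV[R^c]_n -> N}),
    exact_at a b /\ surj b.

Definition pure_exact (A B C : lmodType R)
  (f : {linear A -> B}) (g : {linear B -> C}) : Prop :=
  short_exact f g /\
  forall N : lmodType R^c, fp_right_module N ->
    short_exact (tensor_map N f) (tensor_map N g).

Definition pure_mono (A B : lmodType R) (f : {linear A -> B}) : Prop :=
  exists (C : lmodType R) (g : {linear B -> C}), pure_exact f g.

Definition precomp (A B U : lmodType R) (f : {linear A -> B})
  (h : {linear B -> U}) : {linear A -> U} := comp_lin h f.

Definition pure_injective (U : lmodType R) : Prop :=
  forall (A B C : lmodType R) (f : {linear A -> B}) (g : {linear B -> C}),
    pure_exact f g -> short_exact (@precomp B C U g) (@precomp A B U f).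

(* 0 -> M -> U -> V is a pure-injective copresentation.  In the last clause
   (C, p) is the cokernel U/M of u and w is the induced map U/M -> V. *)
Definition pi_copresentation (M U V : lmodType R)
  (u : {linear M -> U}) (v : {linear U -> V}) : Prop :=
  [/\ pure_injective U /\ pure_injective V,
      left_exact_seq u v,
      forall N : lmodType R^c, fp_right_module N ->
        left_exact_seq (tensor_map N u) (tensor_map N v),
      pure_mono u
    & exists (C : lmodType R) (p : {linear U -> C}) (w : {linear C -> V}),
        [/\ short_exact u p, w \o p =1 v & pure_mono w]].

End Purity.

(* G is a 0-th right derived functor of F for the pure-exact structure: for
   every pure-injective copresentation 0 -> M -> U -> V there is an exact
   sequence 0 -> G M -> F U -> F V, and these identifications of G M with
   Ker (F U -> F V) are compatible with the morphisms of copresentations.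
   This determines G up to natural isomorphism.  The value of iota outside
   the pure-injective copresentations is irrelevant. *)
Definition is_pure_derived0 (R : pzRingType) (F G : functor R) : Prop :=
  exists iota : forall M U V : lmodType R,
      {linear M -> U} -> {linear U -> V} -> {additive G M -> F U},
    (forall (M U V : lmodType R) (u : {linear M -> U}) (v : {linear U -> V}),
       pi_copresentation u v -> left_exact_seq (iota M U V u v) (fmap F v)) /\
    (forall (M U V M' U' V' : lmodType R)
       (u : {linear M -> U}) (v : {linear U -> V})
       (u' : {linear M' -> U'}) (v' : {linear U' -> V'})
       (f : {linear M -> M'}) (g : {linear U -> U'}) (h : {linear V -> V'}),
       pi_copresentation u v -> pi_copresentation u' v' ->
       g \o u =1 u' \o f -> h \o v =1 v' \o g ->
       iota M' U' V' u' v' \o fmap G f =1 fmap F g \o iota M U V u v).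

(* Main.v *)
Require Import Defs.
From HB Require Import structures.
From mathcomp Require Import all_boot all_algebra generic_quotient ring_quotient.
From mathcomp Require Import boolp classical_sets freeg.

Set Implicit Arguments.
Unset Strict Implicit.
Unset Printing Implicit Defensive.

Import GRing.Theory Num.Theory.
Local Open Scope ring_scope.
Local Open Scope quotient_scope.

(** Let F be the cokernel of (Y,-) -> (X,-), induced by f : X -> Y, and let K be
    the kernel of - (x) X -> - (x) Y, as a functor on finitely presented right
    modules.  If U is pure-injective then - (x) U is an injective functor, so
    F U, the cokernel of Nat(- (x) Y, - (x) U) -> Nat(- (x) X, - (x) U), is
    Nat(K, - (x) U).  A pure-injective copresentation 0 -> M -> U -> V stays
    left exact when Nat(K, - (x) -) is applied, so the derived functor is
    M |-> Nat(K, - (x) M).  Presenting K by representables turns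
    Nat(K, - (x) M) into the kernel of a map between products of groups
    N (x) M with N finitely presented.  Each N (x) M is finitely presented as a
    functor of M, and finitely presented functors are closed under products and
    kernels.

    A finitely presented right module is the cokernel of a matrix S, and then
    N (x) M is the group M^n modulo S M^m (tensor_presentation).  Working with
    matrices keeps all the index types small.  A point of K is a matrix S with
    a vector x of X^n such that f x lies in S Y^m (kpoint); an element of
    Nat(K, - (x) M) is represented by a choice of a vector over M for every
    point, compatible with the morphisms of K, modulo the families whose
    members vanish in N (x) M (compatible, negligible).  Being compatible or
    negligible means that linear equations have a solution, so both
    conditions are represented by modules given by generators and relations,
    and the functor is the cokernel of a map between two representables
    (family_to_negligible, negligible_family_of).

    That - (x) U is injective is used in two forms.  A map X -> U that is
    negligible on K factors through f (kernel_point_factor), because U splits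
    off the pushout of f along it; a compatible family in U comes from a map
    X -> U (family_extend).  The second is proved for the character modules
    Hom(N, Q/Z), where it reduces to the injectivity of Q/Z (QZ_extension), and
    passes to every U, a retract of a product of character modules
    (envelope_embedding).  These products also show that every module has a
    pure-injective copresentation (pi_copresentation_exists), whence any two
    derived functors of F are isomorphic (pure_derived0_iso). *)

(** * Additive and linear maps from relations; cokernels *)
Section MapsFromGraphs.

Definition additive_pack (A B : zmodType) (f : A -> B) (fB : zmod_morphism f) :
  {additive A -> B} := HB.pack f (GRing.isZmodMorphism.Build A B f fB).

Definition linear_pack (R : pzRingType) (A B : lmodType R) (f : A -> B)
    (fP : linear f) : {linear A -> B} :=
  HB.pack f (GRing.isLinear.Build R A B *:%R f fP).

Lemma additive_of_graph (A B : zmodType) (G : A -> B -> Prop) :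
    (forall a, exists b, G a b) -> (forall b, G 0 b -> b = 0) ->
    (forall a b a' b', G a b -> G a' b' -> G (a - a') (b - b')) ->
  exists f : {additive A -> B}, forall a, G a (f a).
Proof.
move=> /choice[f Gf] G0 GB.
have fB : zmod_morphism f.
  move=> x y; have := GB _ _ _ _ (Gf (x - y)) (GB _ _ _ _ (Gf x) (Gf y)).
  by rewrite subrr => /G0/eqP; rewrite subr_eq0 => /eqP.
by exists (additive_pack fB).
Qed.

Lemma linear_of_graph (R : pzRingType) (A B : lmodType R) (G : A -> B -> Prop) :
    (forall a, exists b, G a b) -> (forall b, G 0 b -> b = 0) ->
    (forall r a b a' b', G a b -> G a' b' -> G (r *: a + a') (r *: b + b')) ->
  exists f : {linear A -> B}, forall a, G a (f a).
Proof.
move=> /choice[f Gf] G0 GZ.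
have fZ : linear f.
  move=> r x y.
  have := GZ (-1) _ _ _ _ (Gf (r *: x + y)) (GZ r _ _ _ _ (Gf x) (Gf y)).
  by rewrite !scaleN1r addNr [X in G 0 X]addrC => /G0/eqP; rewrite subr_eq0 => /eqP.
by exists (linear_pack fZ).
Qed.

Lemma additive_factor (A B C : zmodType) (p : {additive A -> B})
    (g : {additive A -> C}) :
    surj p -> (forall a, p a = 0 -> g a = 0) ->
  exists h : {additive B -> C}, forall a, h (p a) = g a.
Proof.
move=> ps kpg.
have [b|b [a /kpg -> ->] //|_ _ _ _ [a <- <-] [a' <- <-]|h hP] :=
    @additive_of_graph B C (fun b c => exists2 a, p a = b & g a = c).
- by have [a pa] := ps b; exists (g a), a.
- by exists (a - a'); rewrite raddfB.
exists h => a; have [a' pa' <-] := hP (p a).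
have /kpg : p (a' - a) = 0 by rewrite raddfB pa' subrr.
by rewrite raddfB => /subr0_eq.
Qed.

Lemma linear_factor (R : pzRingType) (A B C : lmodType R) (p : {linear A -> B})
    (g : {linear A -> C}) :
    surj p -> (forall a, p a = 0 -> g a = 0) ->
  exists h : {linear B -> C}, forall a, h (p a) = g a.
Proof.
move=> ps kpg.
have [b|b [a /kpg -> ->] //|r _ _ _ _ [a <- <-] [a' <- <-]|h hP] :=
    @linear_of_graph R B C (fun b c => exists2 a, p a = b & g a = c).
- by have [a pa] := ps b; exists (g a), a.
- by exists (r *: a + a'); rewrite linearP.
exists h => a; have [a' pa' <-] := hP (p a).
have /kpg : p (a' - a) = 0 by rewrite linearB pa' subrr.
by rewrite linearB => /subr0_eq.
Qed.

End MapsFromGraphs.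

Section Cokernel.
Variables (A B : zmodType) (f : {additive A -> B}).

Definition image_pred : {pred B} := fun b => `[< exists a, f a = b >].

Lemma image_pred_zmod_closed : zmod_closed image_pred.
Proof.
split=> [|_ _ /asboolP[a <-] /asboolP[b <-]]; apply/asboolP.
  by exists 0; rewrite raddf0.
by exists (a - b); rewrite raddfB.
Qed.

HB.instance Definition _ :=
  GRing.isZmodClosed.Build B image_pred image_pred_zmod_closed.

Definition coker : zmodType := Quotient.quot image_pred.

Lemma coker_pi_is_zmod_morphism : zmod_morphism (fun b : B => \pi_coker b).
Proof. by move=> a b; rewrite raddfB. Qed.

Definition coker_pi : {additive B -> coker} :=
  additive_pack coker_pi_is_zmod_morphism.

Lemma coker_pi_surj : surj coker_pi.
Proof. by move=> c; exists (repr c); apply: reprK. Qed.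

Lemma coker_exact : exact_at f coker_pi.
Proof.
move=> b; rewrite -(raddf0 coker_pi); split=> [/eqP|fb]; last apply/eqP.
all: rewrite -[_ == _]/(_ == _ %[mod Quotient.quot _]) -Quotient.idealrBE subr0.
  by move/asboolP.
exact/asboolP.
Qed.

End Cokernel.

Section LinearCokernel.
Variables (R : pzRingType) (A B : lmodType R) (f : {linear A -> B}).

Definition lcoker : Type := coker f.
HB.instance Definition _ := GRing.Zmodule.on lcoker.

Let p : {additive B -> lcoker} := coker_pi f.

Let p_surj : surj p.
Proof. exact: coker_pi_surj. Qed.

Definition lcoker_scale (r : R) (c : lcoker) : lcoker := p (r *: repr c).

Lemma lcoker_scale_pi r b : lcoker_scale r (p b) = p (r *: b).
Proof.
apply/eqP; rewrite -subr_eq0 -raddfB -scalerBr; apply/eqP/(coker_exact f).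
have [a fa] : exists a, f a = repr (p b) - b.
  apply/(coker_exact f); rewrite raddfB; apply/eqP; rewrite subr_eq0; apply/eqP.
  exact: reprK.
by exists (r *: a); rewrite -fa -linearZ.
Qed.

Lemma lcoker_scaleA r s c :
  lcoker_scale r (lcoker_scale s c) = lcoker_scale (r * s) c.
Proof.
by have [b <-] := p_surj c; rewrite !lcoker_scale_pi scalerA.
Qed.

Lemma lcoker_scale1 : left_id 1 lcoker_scale.
Proof.
by move=> c; have [b <-] := p_surj c; rewrite lcoker_scale_pi scale1r.
Qed.

Lemma lcoker_scaleDr : right_distributive lcoker_scale +%R.
Proof.
move=> r c d; have [b <-] := p_surj c; have [b' <-] := p_surj d.
by rewrite -raddfD !lcoker_scale_pi -raddfD scalerDr.
Qed.

Lemma lcoker_scaleDl c : {morph lcoker_scale^~ c : r s / r + s}.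
Proof.
move=> r s; have [b <-] := p_surj c.
by rewrite !lcoker_scale_pi -raddfD scalerDl.
Qed.

HB.instance Definition _ := GRing.Zmodule_isLmodule.Build R lcoker
  lcoker_scaleA lcoker_scale1 lcoker_scaleDr lcoker_scaleDl.

Lemma lcoker_pi_is_linear : linear p.
Proof.
by move=> r a b; rewrite raddfD -lcoker_scale_pi.
Qed.

Definition lcoker_pi : {linear B -> lcoker} := linear_pack lcoker_pi_is_linear.

Lemma lcoker_pi_surj : surj lcoker_pi.
Proof. exact: coker_pi_surj. Qed.

Lemma lcoker_exact : exact_at f lcoker_pi.
Proof. exact: coker_exact. Qed.

End LinearCokernel.

(** * Q/Z is an injective cogenerator of abelian groups *)
Section RationalsModuloIntegers.

(** Subgroups of the integers are principal; the generator n = 0 covers the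
    trivial subgroup. *)
Lemma int_subgroup_dvd (P : int -> Prop) :
    P 0 -> (forall k l, P k -> P l -> P (k - l)) ->
  exists n : nat, forall k, P k <-> (n %| k)%Z.
Proof.
move=> P0 PB.
have PN k : P k -> P (- k) by rewrite -sub0r; apply: PB.
have PD k l : P k -> P l -> P (k + l).
  by move=> Pk /PN; rewrite -{2}[l]opprK; apply: PB.
have PM n : P n -> forall k, P (n * k).
  move=> Pn; have Pnk (k : nat) : P (n * k).
    by elim: k => [|k IHk]; rewrite ?mulr0 // intS mulrDr mulr1; apply: PD.
  by case=> k //; rewrite NegzE mulrN; apply: PN.
have [[n [n0 Pn]]|noP] := pselect (exists n : nat, (0 < n)%N /\ P n); last first.
  exists 0 => k; rewrite dvd0z; split=> [Pk|/eqP-> //].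
  apply: contra_notT noP => k0; exists `|k|%N; rewrite absz_gt0; split=> //.
  rewrite abszE; case: (ger0P k) => _ //; exact: PN.
have exn : exists n : nat, `[< (0 < n)%N /\ P n >] by exists n; apply/asboolP.
case: (ex_minnP exn) => {n n0 Pn} n /asboolP[n0 Pn] nmin.
exists n => k; split=> [Pk|/dvdzP[q ->]]; last by rewrite mulrC; apply: PM.
have Pr : P (k %% n)%Z.
  by rewrite /modz mulrC; apply: PB => //; apply: PM.
have r0 : 0 <= (k %% n)%Z by rewrite modz_ge0 // eqz_nat -lt0n.
have rn : (k %% n)%Z < n by rewrite ltz_pmod // ltz_nat.
apply/dvdz_mod0P; case: (k %% n)%Z Pr r0 rn => // r Pr _ rn.
have [-> //|r_gt0] := posnP r.
move: rn; rewrite ltz_nat ltnNge => /negP[].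
by apply: nmin; apply/asboolP.
Qed.

Definition QZ : zmodType := coker (intr : {additive int -> rat}).
Definition QZ_pi : {additive rat -> QZ} := coker_pi _.

Lemma QZ_divisible (n : nat) (d : QZ) : (0 < n)%N -> exists e : QZ, e *+ n = d.
Proof.
move=> n0; have [q <-] := @coker_pi_surj _ _ (intr : {additive int -> rat}) d.
exists (QZ_pi (q / n%:R)); rewrite -raddfMn -[_ *+ n]mulr_natr divfK //.
by rewrite pnatr_eq0 -lt0n.
Qed.

(** The class of 1/n works, and that of 1/2 if n = 0. *)
Lemma QZ_torsion (n : nat) : n != 1%N ->
  exists2 d : QZ, d != 0 & forall k : int, (n %| k)%Z -> d *~ k = 0.
Proof.
move=> n1; pose m := if n == 0%N then 2%N else n.
have m1 : (1 < m)%N by rewrite /m; case: (n) n1 => [|[]].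
have m0 : m%:R != 0 :> rat by rewrite pnatr_eq0; case: (m) m1.
exists (QZ_pi (m%:R^-1)).
  apply/eqP => /(@coker_exact _ _ (intr : {additive int -> rat}))[z].
  move=> zE; have zm : z * m = 1.
    apply/eqP; rewrite -(eqr_int rat) intrM; apply/eqP.
    by rewrite [z%:~R]zE -pmulrn mulVf.
  have : (m%:Z %| 1)%Z by apply/dvdzP; exists z; rewrite zm.
  by rewrite dvdzE dvdn1 => /eqP /= mE; rewrite mE in m1.
move=> k nk; have : (m %| k)%Z.
  by move: nk; rewrite /m; case: eqP => // ->; rewrite dvd0z => /eqP ->.
move=> /dvdzP[q ->]; rewrite -raddfMz.
apply/(@coker_exact _ _ (intr : {additive int -> rat})); exists q.
rewrite mulrC mulrzA -[X in X *~ q]mulrzr [X in X *~ q](mulVf m0) //.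
Qed.

End RationalsModuloIntegers.

Section QZInjective.
Variable V : zmodType.


(** Zorn's lemma applied to single-valued additive relations containing G.  A
    maximal one is total: for v outside its domain, the multiples of v in
    the domain are those of some n v, and divisibility of Q/Z gives a value at
    v.  Stating the hypotheses on the relation, instead of on a subgroup with a
    homomorphism, lets the applications describe a subgroup by a formula. *)
Lemma QZ_extension (G : V -> QZ -> Prop) :
    G 0 0 ->
    (forall a d b e, G a d -> G b e -> G (a - b) (d - e)) ->
    (forall d, G 0 d -> d = 0) ->
  exists h : {additive V -> QZ}, forall v d, G v d -> h v = d.
Proof.
move=> G00 GB G0.
(* The clause on G lets the empty chain through. *)
pose P (H : set (V * QZ)) := [/\
  forall a d b e, H (a, d) -> H (b, e) -> H (a - b, d - e),
  forall d, H (0, d) -> d = 0 &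
  (exists p, H p) -> forall a d, G a d -> H (a, d)].
have [|H [[HB H0 HG] Hmax]] := @Zorn_bigcup _ P.
  move=> F FP Ftot; split.
  - move=> a d b e [X FX Xa] [Y FY Yb].
    have [XY|YX] := Ftot _ _ FX FY.
      by exists Y => //; have [YB _ _] := FP _ FY; apply: YB => //; apply: XY.
    by exists X => //; have [XB _ _] := FP _ FX; apply: XB => //; apply: YX.
  - by move=> d [X FX X0]; have [_ + _] := FP _ FX; apply.
  - move=> [p [X FX Xp]] a d Gad; exists X => //.
    by have [_ _ XG] := FP _ FX; apply: XG => //; exists p.
have {}HG a d : G a d -> H (a, d).
  apply: HG; apply: contrapT => nH; apply: (Hmax [set p | G p.1 p.2]%classic).
    split=> [p Hp|/(_ (0, 0) G00) H00]; first by case: nH; exists p.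
    by case: nH; exists (0, 0).
  by split=> //=.
have H00 : H (0, 0) by apply: HG.
have HN a d : H (a, d) -> H (- a, - d).
  by move=> Had; rewrite -[- a]sub0r -[- d]sub0r; apply: HB.
have HD a d b e : H (a, d) -> H (b, e) -> H (a + b, d + e).
  by move=> Had /HN; rewrite -[b in a + b]opprK -[e in d + e]opprK; apply: HB.
have HM a d (k : int) : H (a, d) -> H (a *~ k, d *~ k).
  move=> Had; have HMn (n : nat) : H (a *~ n, d *~ n).
    by elim: n => [|n IHn]; rewrite ?mulr0z // intS !mulrzDr !mulr1z; apply: HD.
  by case: k => k //; rewrite NegzE !mulrNz; apply: HN.
have Htot v : exists d, H (v, d).
  apply: contrapT => nHv.
  have [||n nP] := @int_subgroup_dvd (fun k => exists e, H (v *~ k, e)).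
  - by exists 0; rewrite mulr0z.
  - move=> k l [e He] [e' He']; exists (e - e').
    by rewrite mulrzBr; apply: HB.
  have [e0 He0] : exists e, H (v *~ n, e) by apply/nP; apply: dvdzz.
  have [d0 d0n] : exists d0, d0 *~ n = e0.
    have [n0|n0] := posnP n; last exact: QZ_divisible.
    by exists 0; rewrite mul0rz; apply/esym/H0; rewrite n0 mulr0z in He0.
  have dP (k : int) e : H (v *~ k, e) -> e = d0 *~ k.
    move=> He; have /dvdzP[q kE] : (n %| k)%Z by apply/nP; exists e.
    apply/subr0_eq/H0; rewrite -[0](subrr (v *~ k)); apply: HB => //.
    by rewrite kE mulrC !mulrzA d0n; apply: HM.
  pose H' := [set p | exists a e (k : int),
    [/\ H (a, e), p.1 = a + v *~ k & p.2 = e + d0 *~ k]]%classic.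
  apply: (Hmax H').
    split=> [[a e] Hae|sub]; first by exists a, e, 0; rewrite !mulr0z !addr0.
    apply: nHv; exists d0; apply: sub; exists 0, 0, 1 => /=.
    by rewrite !mulr1z !add0r.
  split=> [a d b e|d|_ a d Gad].
  - move=> [a' [d' [k [Hk /= -> ->]]]] [b' [e' [l [Hl /= -> ->]]]].
    exists (a' - b'), (d' - e'), (k - l) => /=; rewrite !mulrzBr.
    by split; [apply: HB | rewrite opprD addrACA | rewrite opprD addrACA].
  - move=> [a [e [k [Hae /= /eqP + ->]]]].
    rewrite eq_sym addr_eq0 -mulrNz => /eqP aE; rewrite aE in Hae.
    by rewrite (dP _ _ Hae) mulrNz addNr.
  - exists a, d, 0 => /=; rewrite !mulr0z !addr0; split=> //; exact: HG.
have [|h hP] := @additive_of_graph V QZ (fun v d => H (v, d)) Htot H0.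
  by move=> *; apply: HB.
exists h => v d /HG Hvd; apply/subr0_eq/H0.
by rewrite -[0](subrr v); apply: HB.
Qed.

(** If the multiples of v in S are those of n v, then n <> 1, and sending S to 0
    and v to a nonzero element killed by n is a single-valued relation. *)
Lemma QZ_separation (S : V -> Prop) (v : V) :
    S 0 -> (forall a b, S a -> S b -> S (a - b)) -> ~ S v ->
  exists2 h : {additive V -> QZ}, forall a, S a -> h a = 0 & h v != 0.
Proof.
move=> S0 SB nSv.
have [||n nP] := @int_subgroup_dvd (fun k => S (v *~ k)).
- by rewrite mulr0z.
- by move=> k l Sk Sl; rewrite mulrzBr; apply: SB.
have [|d d0 dP] := @QZ_torsion n.
  by apply: contra_notN nSv => /eqP n1; rewrite -[v]mulr1z; apply/nP; rewrite n1.
have SN a : S a -> S (- a) by rewrite -sub0r; apply: SB.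
have [||b|h hP] := @QZ_extension
  (fun b e => exists a (k : int), [/\ S a, b = a + v *~ k & e = d *~ k]).
- by exists 0, 0; rewrite !mulr0z addr0.
- move=> _ _ _ _ [a [k [Sa -> ->]]] [b [l [Sb -> ->]]].
  exists (a - b), (k - l); rewrite !mulrzBr opprD addrACA; split=> //; exact: SB.
- move=> [a [k [Sa /eqP + ->]]]; rewrite eq_sym addr_eq0 => /eqP aE.
  by apply: dP; apply/nP; rewrite -[_ *~ _]opprK -aE; apply: SN.
exists h => [a Sa|]; first by apply: hP; exists a, 0; rewrite !mulr0z addr0.
suff -> : h v = d by [].
by apply: hP; exists 0, 1; rewrite !mulr1z add0r.
Qed.

End QZInjective.

(** * Character modules and direct products *)
Section CharacterModule.
Variables (R : pzRingType) (N : lmodType R^c).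

Definition dual := {additive N -> QZ}.
Implicit Types f g h : dual.

HB.instance Definition _ := gen_eqMixin dual.
HB.instance Definition _ := gen_choiceMixin dual.

Lemma additive_ext f g : f =1 g -> f = g.
Proof.
case: f g => [f [[cf]]] [g [[cg]]] /= /funext efg.
by move: cf cg; rewrite -efg => cf cg; rewrite (Prop_irrelevance cf cg).
Qed.

Definition dual_zero : dual := \0.
Definition dual_opp f : dual := \- f.
Definition dual_add f g : dual := f \+ g.

Lemma dual_addA : associative dual_add.
Proof. by move=> f g h; apply: additive_ext => x /=; rewrite addrA. Qed.

Lemma dual_addC : commutative dual_add.
Proof. by move=> f g; apply: additive_ext => x /=; rewrite addrC. Qed.

Lemma dual_add0 : left_id dual_zero dual_add.
Proof. by move=> f; apply: additive_ext => x /=; rewrite add0r. Qed.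

Lemma dual_addN : left_inverse dual_zero dual_opp dual_add.
Proof. by move=> f; apply: additive_ext => x /=; rewrite addNr. Qed.

HB.instance Definition _ := GRing.isZmodule.Build dual
  dual_addA dual_addC dual_add0 dual_addN.

Lemma dual_scale_is_zmod_morphism (r : R) f :
  zmod_morphism (fun x : N => f ((r : R^c) *: x)).
Proof. by move=> x y; rewrite scalerBr raddfB. Qed.

Definition dual_scale (r : R) f : dual :=
  additive_pack (dual_scale_is_zmod_morphism r f).

Lemma dual_scaleA r s f : dual_scale r (dual_scale s f) = dual_scale (r * s) f.
Proof. by apply: additive_ext => x /=; rewrite scalerA. Qed.

Lemma dual_scale1 : left_id 1 dual_scale.
Proof. by move=> f; apply: additive_ext => x /=; rewrite scale1r. Qed.

Lemma dual_scaleDr : right_distributive dual_scale +%R.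
Proof. by move=> r f g; apply: additive_ext. Qed.

Lemma dual_scaleDl f : {morph dual_scale^~ f : r s / r + s}.
Proof.
by move=> r s; apply: additive_ext => x /=; rewrite scalerDl raddfD.
Qed.

HB.instance Definition _ := GRing.Zmodule_isLmodule.Build R dual
  dual_scaleA dual_scale1 dual_scaleDr dual_scaleDl.

Lemma dualD f g x : (f + g) x = f x + g x. Proof. by []. Qed.
Lemma dualB f g x : (f - g) x = f x - g x. Proof. by []. Qed.
Lemma dualZ r f x : (r *: f) x = f ((r : R^c) *: x). Proof. by []. Qed.

Lemma dual_sum (I : Type) (s : seq I) (P : pred I) (F : I -> dual) x :
  (\sum_(i <- s | P i) F i) x = \sum_(i <- s | P i) F i x.
Proof. by elim/big_rec2: _ => // i _ y _ <-. Qed.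

End CharacterModule.

Section DirectProduct.
Variables (R : pzRingType) (I : Type) (M : I -> lmodType R).

Definition dprod := forall i, M i.
Implicit Types x y z : dprod.

HB.instance Definition _ := gen_eqMixin dprod.
HB.instance Definition _ := gen_choiceMixin dprod.

Definition dprod_zero : dprod := fun=> 0.
Definition dprod_opp x : dprod := fun i => - x i.
Definition dprod_add x y : dprod := fun i => x i + y i.
Definition dprod_scale (r : R) x : dprod := fun i => r *: x i.

Lemma dprod_addA : associative dprod_add.
Proof. by move=> x y z; apply: functional_extensionality_dep => i; apply: addrA. Qed.

Lemma dprod_addC : commutative dprod_add.
Proof. by move=> x y; apply: functional_extensionality_dep => i; apply: addrC. Qed.

Lemma dprod_add0 : left_id dprod_zero dprod_add.
Proof. by move=> x; apply: functional_extensionality_dep => i; apply: add0r. Qed.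

Lemma dprod_addN : left_inverse dprod_zero dprod_opp dprod_add.
Proof. by move=> x; apply: functional_extensionality_dep => i; apply: addNr. Qed.

HB.instance Definition _ := GRing.isZmodule.Build dprod
  dprod_addA dprod_addC dprod_add0 dprod_addN.

Lemma dprod_scaleA r s x : dprod_scale r (dprod_scale s x) = dprod_scale (r * s) x.
Proof. by apply: functional_extensionality_dep => i; apply: scalerA. Qed.

Lemma dprod_scale1 : left_id 1 dprod_scale.
Proof. by move=> x; apply: functional_extensionality_dep => i; apply: scale1r. Qed.

Lemma dprod_scaleDr : right_distributive dprod_scale +%R.
Proof. by move=> r x y; apply: functional_extensionality_dep => i; apply: scalerDr. Qed.

Lemma dprod_scaleDl x : {morph dprod_scale^~ x : r s / r + s}.
Proof. by move=> r s; apply: functional_extensionality_dep => i; apply: scalerDl. Qed.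

HB.instance Definition _ := GRing.Zmodule_isLmodule.Build R dprod
  dprod_scaleA dprod_scale1 dprod_scaleDr dprod_scaleDl.

Lemma dprod_proj_is_linear i : linear (fun x : dprod => x i).
Proof. by []. Qed.

Definition dprod_proj i : {linear dprod -> M i} :=
  linear_pack (@dprod_proj_is_linear i).

Lemma dprod_lift (B : lmodType R) (F : forall i, {linear B -> M i}) :
  exists f : {linear B -> dprod}, forall b i, f b i = F i b.
Proof.
have fP : linear (fun b => (fun i => F i b) : dprod).
  by move=> r a b; apply: functional_extensionality_dep => i; apply: linearP.
by exists (linear_pack fP).
Qed.

End DirectProduct.

(** * Matrices over R acting on vectors of module elements *)
Section Action.
Variable R : pzRingType.

Definition vmap (A B : lmodType R) n (f : {linear A -> B})
  (v : {ffun 'I_n -> A}) : {ffun 'I_n -> B} := [ffun k => f (v k)].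

(** The rows of A are elements of the free right module of row vectors, which is
    why A has its entries in R^c and its indices appear transposed. *)
Definition act (M : lmodType R) m n (A : 'M[R^c]_(m, n))
  (w : {ffun 'I_m -> M}) : {ffun 'I_n -> M} :=
  [ffun k => \sum_i (A i k : R) *: w i].

Lemma act_is_zmod_morphism (M : lmodType R) m n (A : 'M[R^c]_(m, n)) :
  zmod_morphism (@act M m n A).
Proof.
move=> v w; apply/ffunP=> k; rewrite !ffunE -sumrB.
by apply: eq_bigr => i _; rewrite !ffunE scalerBr.
Qed.

HB.instance Definition _ (M : lmodType R) m n (A : 'M[R^c]_(m, n)) := 
  GRing.isZmodMorphism.Build {ffun 'I_m -> M} {ffun 'I_n -> M} (@act M m n A)
    (@act_is_zmod_morphism M m n A).

Lemma vmap_is_linear (A B : lmodType R) n (f : {linear A -> B}) :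
  linear (@vmap A B n f).
Proof. by move=> r v w; apply/ffunP=> k; rewrite !ffunE linearP. Qed.

HB.instance Definition _ (A B : lmodType R) n (f : {linear A -> B}) := 
  GRing.isLinear.Build R {ffun 'I_n -> A} {ffun 'I_n -> B} *:%R (@vmap A B n f)
    (@vmap_is_linear A B n f).

Lemma actB (M : lmodType R) m n (A : 'M[R^c]_(m, n)) (v w : {ffun 'I_m -> M}) :
  act A (v - w) = act A v - act A w.
Proof. exact: (@raddfB {ffun 'I_m -> M}). Qed.

Lemma actD (M : lmodType R) m n (A : 'M[R^c]_(m, n)) (v w : {ffun 'I_m -> M}) :
  act A (v + w) = act A v + act A w.
Proof. exact: (@raddfD {ffun 'I_m -> M}). Qed.

Lemma actN (M : lmodType R) m n (A : 'M[R^c]_(m, n)) (v : {ffun 'I_m -> M}) :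
  act A (- v) = - act A v.
Proof. exact: (@raddfN {ffun 'I_m -> M}). Qed.

Lemma act0 (M : lmodType R) m n (A : 'M[R^c]_(m, n)) :
  act A (0 : {ffun 'I_m -> M}) = 0.
Proof. exact: (@raddf0 {ffun 'I_m -> M}). Qed.

Lemma vmapB (A B : lmodType R) n (f : {linear A -> B}) (v w : {ffun 'I_n -> A}) :
  vmap f (v - w) = vmap f v - vmap f w.
Proof. exact: (@raddfB {ffun 'I_n -> A}). Qed.

Lemma vmapD (A B : lmodType R) n (f : {linear A -> B}) (v w : {ffun 'I_n -> A}) :
  vmap f (v + w) = vmap f v + vmap f w.
Proof. exact: (@raddfD {ffun 'I_n -> A}). Qed.

Lemma vmap0 (A B : lmodType R) n (f : {linear A -> B}) :
  vmap f (0 : {ffun 'I_n -> A}) = 0.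
Proof. exact: (@raddf0 {ffun 'I_n -> A}). Qed.

Lemma act_vmap (M M' : lmodType R) (f : {linear M -> M'}) m n
    (A : 'M[R^c]_(m, n)) (w : {ffun 'I_m -> M}) :
  vmap f (act A w) = act A (vmap f w).
Proof.
apply/ffunP=> k; rewrite !ffunE linear_sum; apply: eq_bigr => i _.
by rewrite !ffunE linearZ.
Qed.

Lemma act_mul (M : lmodType R) l m n (A : 'M[R^c]_(l, m)) (B : 'M[R^c]_(m, n))
    (w : {ffun 'I_l -> M}) :
  act B (act A w) = act (A *m B) w.
Proof.
apply/ffunP=> k; rewrite !ffunE.
under eq_bigr => i _ do rewrite ffunE scaler_sumr.
rewrite exchange_big; apply: eq_bigr => i _ /=.
rewrite mxE -[X in X *: _]/(_ : R) scaler_suml.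
by apply: eq_bigr => j _; rewrite scalerA.
Qed.

Lemma act1 (M : lmodType R) n (w : {ffun 'I_n -> M}) :
  act (1%:M : 'M[R^c]_n) w = w.
Proof.
apply/ffunP=> k; rewrite !ffunE (bigD1 k) //= mxE eqxx.
rewrite [X in _ + X]big1 ?addr0 ?scale1r // => i ik.
by rewrite mxE (negPf ik) scale0r.
Qed.

Lemma act0mx (M : lmodType R) m n (w : {ffun 'I_m -> M}) :
  act (0 : 'M[R^c]_(m, n)) w = 0.
Proof.
by apply/ffunP=> k; rewrite !ffunE big1 // => i _; rewrite mxE scale0r.
Qed.

Lemma actNmx (M : lmodType R) m n (A : 'M[R^c]_(m, n)) (w : {ffun 'I_m -> M}) :
  act (- A) w = - act A w.
Proof.
apply/ffunP=> k; rewrite !ffunE -sumrN; apply: eq_bigr => i _.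
by rewrite mxE scaleNr.
Qed.

Lemma act_smul (M : lmodType R) m n (A : 'M[R^c]_(m, n)) (u : 'rV[R^c]_m)
    (x : M) :
  act A [ffun i => (u 0 i : R) *: x] = [ffun k => ((u *m A) 0 k : R) *: x].
Proof.
apply/ffunP=> k; rewrite !ffunE mxE scaler_suml.
by apply: eq_bigr => i _; rewrite ffunE scalerA.
Qed.

End Action.

(** * Tensor products with finitely presented right modules *)
Section TensorProduct.
Variables (R : pzRingType) (N : lmodType R^c) (M : lmodType R).

Lemma tensor_pi_eq0 (t : tensor_free N M) :
  t \in tensor_relations N M -> \pi_(tensor N M) t = 0.
Proof.
move=> tr; apply/eqP; rewrite -(raddf0 (\pi_(tensor N M))).
by rewrite -[_ == _]/(_ == _ %[mod Quotient.quot _]) -Quotient.idealrBE subr0.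
Qed.

Lemma tensDl x y m : tens (x + y) m = tens x m + tens y m :> tensor N M.
Proof.
have [r1 _ _] := tensor_relations_contains N M.
have := tensor_pi_eq0 (r1 x y m); rewrite !raddfB /= => /eqP.
by rewrite -addrA -opprD subr_eq0 => /eqP; rewrite addrC.
Qed.

Lemma tensDr x m n : tens x (m + n) = tens x m + tens x n :> tensor N M.
Proof.
have [_ r2 _] := tensor_relations_contains N M.
have := tensor_pi_eq0 (r2 x m n); rewrite !raddfB /= => /eqP.
by rewrite -addrA -opprD subr_eq0 => /eqP.
Qed.

Lemma tensZ (r : R) x m : tens ((r : R^c) *: x) m = tens x (r *: m) :> tensor N M.
Proof.
have [_ _ r3] := tensor_relations_contains N M.
have := tensor_pi_eq0 (r3 r x m); rewrite !raddfB /= => /eqP.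
by rewrite subr_eq0 => /eqP.
Qed.

Lemma tensor_lift (W : zmodType) (b : N -> M -> W) :
    (forall x y m, b (x + y) m = b x m + b y m) ->
    (forall x m n, b x (m + n) = b x m + b x n) ->
    (forall (r : R) x m, b ((r : R^c) *: x) m = b x (r *: m)) ->
  exists h : {additive tensor N M -> W}, forall x m, h (tens x m) = b x m.
Proof.
move=> bDl bDr bZ.
(* fglift needs an int-module as its target. *)
pose g : tensor_free N M -> zmodule W :=
  fglift (fun p : N * M => b p.1 p.2 : zmodule W).
have gB : zmod_morphism g by exact: lift_is_additive.
have gT x m : g (free_tens x m) = b x m.
  by rewrite /g /free_tens liftU scale1r.
have b0 x m : b x m - b x m = 0 by rewrite subrr.
have gr t : t \in tensor_relations N M -> g t = 0.
  move=> /tensor_relationsP/(_ [pred s | g s == 0]); rewrite inE => gt.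
  apply/eqP/gt.
    split=> [|s u]; rewrite !inE; first by rewrite -(subrr 0) gB subrr.
    by move=> /eqP gs /eqP gu; rewrite gB gs gu subrr.
  split=> *; rewrite inE !gB !gT ?bDl ?bDr ?bZ ?subrr //.
    by rewrite addrAC addrK subrr.
  by rewrite addrAC addrK subrr.
have [||h hP] := @additive_factor (tensor_free N M) (tensor N M) W
   (additive_pack (fun s t => raddfB \pi_(tensor N M) s t))
   (additive_pack (gB : zmod_morphism (g : tensor_free N M -> W))).
- by elim/quotW=> t; exists t.
- move=> t /eqP; rewrite -[X in _ == X](raddf0 (\pi_(tensor N M))) => t0.
  apply: gr; move: t0.
  rewrite /= -[_ == _]/(_ == _ %[mod Quotient.quot _]) -Quotient.idealrBE.
  by rewrite subr0.
by exists h => x m; rewrite -gT; apply: hP.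
Qed.

Lemma tensor_ind (P : tensor N M -> Prop) :
    P 0 -> (forall s t, P s -> P t -> P (s - t)) ->
    (forall x m, P (tens x m)) ->
  forall t, P t.
Proof.
move=> P0 PB PT; elim/quotW=> t.
have PN s : P s -> P (- s) by rewrite -sub0r; apply: PB.
have PD s u : P s -> P u -> P (s + u).
  by move=> Ps /PN; rewrite -{2}[u]opprK; apply: PB.
have PM s (k : int) : P s -> P (s *~ k).
  move=> Ps; have Pn (n : nat) : P (s *~ n).
    by elim: n => [|n IHn]; rewrite ?mulr0z // intS mulrzDr mulr1z; apply: PD.
  by case: k => k //; rewrite NegzE mulrNz; apply: PN.
rewrite -[t]freeg_sumE raddf_sum; elim/big_rec: _ => // p u _ Pu.
apply: PD => //; rewrite -[coeff _ _]intz -[_%:~R]/(1 *~ _) -freegU_mulz raddfMz.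
by case: p => x m; apply/PM/PT.
Qed.

End TensorProduct.

Section TensorPresentation.
Variable R : pzRingType.

Lemma tens_suml (N : lmodType R^c) (M : lmodType R) (I : Type) (s : seq I)
    (F : I -> N) (m : M) :
  tens (\sum_(i <- s) F i) m = \sum_(i <- s) tens (F i) m.
Proof.
apply: (big_morph (fun x => tens x m)) => [x y|]; first exact: tensDl.
by apply: (addIr (tens 0 m)); rewrite -tensDl !add0r.
Qed.

Lemma tens_sumr (N : lmodType R^c) (M : lmodType R) (I : Type) (s : seq I)
    (x : N) (F : I -> M) :
  tens x (\sum_(i <- s) F i) = \sum_(i <- s) tens x (F i).
Proof.
apply: (big_morph (tens x)) => [m n|]; first exact: tensDr.
by apply: (addIr (tens x 0)); rewrite -tensDr !add0r.
Qed.

(** The map M^n -> N (x) M given by a family e of n elements of N. *)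
Definition tvec (N : lmodType R^c) (M : lmodType R) n (e : 'I_n -> N)
  (v : {ffun 'I_n -> M}) : tensor N M := \sum_k tens (e k) (v k).

Lemma tvec_is_zmod_morphism (N : lmodType R^c) (M : lmodType R) n (e : 'I_n -> N) :
  zmod_morphism (@tvec N M n e).
Proof.
move=> v w; rewrite /tvec -sumrB; apply: eq_bigr => k _.
by rewrite !ffunE; apply/eqP; rewrite eq_sym subr_eq -tensDr subrK.
Qed.

HB.instance Definition _ (N : lmodType R^c) (M : lmodType R) n (e : 'I_n -> N) := 
  GRing.isZmodMorphism.Build {ffun 'I_n -> M} (tensor N M) (@tvec N M n e)
    (@tvec_is_zmod_morphism N M n e).

Lemma tvecB (N : lmodType R^c) (M : lmodType R) n (e : 'I_n -> N)
    (v w : {ffun 'I_n -> M}) :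
  tvec e (v - w) = tvec e v - tvec e w.
Proof. exact: (@raddfB {ffun 'I_n -> M}). Qed.

Lemma tensor_map_tvec (N : lmodType R^c) (A B : lmodType R)
    (f : {linear A -> B}) n (e : 'I_n -> N) (v : {ffun 'I_n -> A}) :
  tensor_map N f (tvec e v) = tvec e (vmap f v).
Proof.
by rewrite raddf_sum; apply: eq_bigr => k _; rewrite /= tensor_map_tens ffunE.
Qed.

(** M^m -> M^n -> N (x) M -> 0 is exact for every M. *)
Definition presents_tensor (N : lmodType R^c) m n (A : 'M[R^c]_(m, n))
    (e : 'I_n -> N) : Prop :=
  forall M : lmodType R, exact_at (@act R M m n A) (tvec e) /\ surj (@tvec N M n e).

(** Right exactness of - (x) M.  For the kernel, an element b u of N paired with x
    is sent to the class of (u_k x)_k in the cokernel of act A.  This depends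
    only on b u, is balanced, and gives a left inverse of the map
    coker (act A) -> N (x) M induced by tvec. *)
Lemma tensor_presentation (N : lmodType R^c) m n (A : 'M[R^c]_(m, n))
    (a : {linear 'rV[R^c]_m -> 'rV[R^c]_n}) (b : {linear 'rV[R^c]_n -> N}) :
    (forall u, a u = u *m A) -> exact_at a b -> surj b ->
  presents_tensor A (fun k => b (delta_mx 0 k)).
Proof.
move=> aE ab bs M; set e := fun k => _.
have bE u : b u = \sum_k u 0 k *: e k.
  by rewrite {1}[u]row_sum_delta linear_sum; apply: eq_bigr => k _; rewrite linearZ.
have e0 i : \sum_k A i k *: e k = 0.
  transitivity (b (a (delta_mx 0 i))); last by apply/ab; exists (delta_mx 0 i).
  by rewrite bE; apply: eq_bigr => k _; rewrite aE -rowE mxE.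
have tb u x : tens (b u) x = tvec e [ffun k => (u 0 k : R) *: x] :> tensor N M.
  by rewrite bE tens_suml; apply: eq_bigr => k _; rewrite ffunE -tensZ.
split=> [v|]; last first.
  apply: tensor_ind.
  - by exists 0; rewrite raddf0.
  - by move=> _ _ [v <-] [w <-]; exists (v - w); rewrite tvecB.
  - by move=> y x; have [u <-] := bs y; rewrite tb; eexists.
split=> [v0|[w <-]]; last first.
  rewrite /tvec; under eq_bigr => k _ do rewrite ffunE tens_sumr.
  rewrite exchange_big big1 // => i _.
  under eq_bigr => k _ do rewrite -tensZ.
  rewrite -tens_suml e0.
  by apply: (addIr (tens 0 (w i))); rewrite -tensDl !add0r.
pose aA : {additive {ffun 'I_m -> M} -> {ffun 'I_n -> M}} := act A.
pose p := coker_pi aA.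
pose s (u : 'rV[R^c]_n) (x : M) : {ffun 'I_n -> M} := [ffun k => (u 0 k : R) *: x].
have ps u u' x : b u = b u' -> p (s u x) = p (s u' x).
  move=> /eqP; rewrite -subr_eq0 -raddfB => /eqP/ab[c ac].
  apply/subr0_eq; rewrite -raddfB; apply/(coker_exact aA).
  exists [ffun i => (c 0 i : R) *: x]; rewrite [LHS]act_smul -aE ac.
  by apply/ffunP=> k; rewrite !ffunE !mxE scalerBl.
have [c cP] := choice bs.
have [|||h hP] := @tensor_lift R N M (coker aA) (fun y x => p (s (c y) x)).
- move=> x y m'; rewrite (ps _ (c x + c y)); last by rewrite linearD !cP.
  rewrite -raddfD.
  by congr (p _); apply/ffunP=> k; rewrite !ffunE !mxE scalerDl.
- move=> x m1 m2; rewrite -raddfD; congr (p _).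
  by apply/ffunP=> k; rewrite !ffunE scalerDr.
- move=> r x m'; rewrite (ps _ ((r : R^c) *: c x)); last by rewrite linearZ !cP.
  by congr (p _); apply/ffunP=> k; rewrite !ffunE !mxE scalerA.
apply/(coker_exact aA); rewrite -/p.
rewrite -(raddf0 h) -v0 raddf_sum.
transitivity (p (\sum_k s (delta_mx 0 k) (v k))); last first.
  by rewrite raddf_sum; apply: eq_bigr => k _; rewrite hP; apply: ps; rewrite cP.
congr (p _); apply/ffunP=> k; rewrite sum_ffunE (bigD1 k) //= big1 => [|j jk].
  by rewrite ffunE mxE !eqxx scale1r addr0.
by rewrite ffunE mxE eqxx eq_sym (negPf jk) scale0r.
Qed.

Lemma fp_presents_tensor (N : lmodType R^c) : fp_right_module N ->
  exists (m n : nat) (A : 'M[R^c]_(m, n)) (e : 'I_n -> N), presents_tensor A e.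
Proof.
move=> [m [n [a [b [ab bs]]]]]; exists m, n, (lin1_mx a); eexists.
by apply: (tensor_presentation _ ab bs) => u; rewrite mul_rV_lin1.
Qed.

Definition matrix_map m n (A : 'M[R^c]_(m, n)) :
  {linear 'rV[R^c]_m -> 'rV[R^c]_n} := mulmxr A.

Definition matrix_module m n (A : 'M[R^c]_(m, n)) : lmodType R^c :=
  lcoker (matrix_map A).

Definition matrix_gen m n (A : 'M[R^c]_(m, n)) (k : 'I_n) : matrix_module A :=
  lcoker_pi (matrix_map A) (delta_mx 0 k).

Lemma matrix_module_fp m n (A : 'M[R^c]_(m, n)) : fp_right_module (matrix_module A).
Proof.
exists m, n, (matrix_map A), (lcoker_pi (matrix_map A)).
by split; [apply: lcoker_exact | apply: lcoker_pi_surj].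
Qed.

Lemma matrix_module_presents m n (A : 'M[R^c]_(m, n)) :
  presents_tensor A (@matrix_gen m n A).
Proof.
apply: (@tensor_presentation (matrix_module A) _ _ _ (matrix_map A)
  (lcoker_pi (matrix_map A))) => //.
  exact: lcoker_exact.
exact: lcoker_pi_surj.
Qed.

End TensorPresentation.

(** * Purity as reflection of solvability of linear systems *)
Section Purity.
Variable R : pzRingType.

(** Systems over A with a solution in B have one in A: the form taken by
    injectivity of 1_N (x) f for finitely presented N, once N (x) A is written as
    A^n modulo S A^m. *)
Definition reflects_systems (A B : lmodType R) (f : {linear A -> B}) : Prop :=
  forall m n (S : 'M[R^c]_(m, n)) (v : {ffun 'I_n -> A}) (w : {ffun 'I_m -> B}),
    act S w = vmap f v -> exists w', act S w' = v.

Lemma reflects_systems_tensor (A B : lmodType R) (f : {linear A -> B}) :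
  reflects_systems f <->
  (forall N : lmodType R^c, fp_right_module N -> injective (tensor_map N f)).
Proof.
split=> [fS N /fp_presents_tensor[m [n [S [e Se]]]]|fN m n S v w wv].
  have [SA sA] := Se A; have [SB _] := Se B.
  apply: raddf_inj => t; have [v <-] := sA t.
  by rewrite /= tensor_map_tvec => /SB[w /fS/SA].
have [SA _] := matrix_module_presents S A; have [SB _] := matrix_module_presents S B.
apply/SA; apply: (fN _ (matrix_module_fp S)).
by rewrite raddf0 tensor_map_tvec; apply/SB; exists w.
Qed.

Lemma reflects_systems_inj (A B : lmodType R) (f : {linear A -> B}) :
  reflects_systems f -> injective f.
Proof.
move=> fS; apply: raddf_inj => x fx.
have [|w] := fS 0 1 0 [ffun=> x] 0.
  by apply/ffunP=> k; rewrite !ffunE big_ord0 fx.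
by move/ffunP/(_ 0); rewrite !ffunE big_ord0 => <-.
Qed.

Lemma act_lift (B C : lmodType R) (g : {linear B -> C}) n (w : {ffun 'I_n -> C}) :
  surj g -> exists v, vmap g v = w.
Proof.
move=> gs; have [h hP] := choice gs.
by exists [ffun k => h (w k)]; apply/ffunP=> k; rewrite !ffunE.
Qed.

Lemma vmap_exact (A B C : lmodType R) (f : {linear A -> B}) (g : {linear B -> C})
  n : exact_at f g -> exact_at (@vmap R A B n f) (@vmap R B C n g).
Proof.
move=> fg v; split=> [gv|[w <-]].
  have /choice[w wP] : forall k, exists a, f a = v k.
    by move=> k; apply/fg; move/ffunP/(_ k): gv; rewrite !ffunE.
  by exists [ffun k => w k]; apply/ffunP=> k; rewrite !ffunE.
by apply/ffunP=> k; rewrite !ffunE; apply/fg; exists (w k).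
Qed.

Lemma pure_exactP (A B C : lmodType R) (f : {linear A -> B}) (g : {linear B -> C}) :
  pure_exact f g <-> short_exact f g /\ reflects_systems f.
Proof.
split=> [[fg fgN]|[[fi fg gs] fS]].
  by split=> //; apply/reflects_systems_tensor => N /fgN[].
split=> // N Nfp; split; first exact: (reflects_systems_tensor f).1.
  have [m [n [S [e Se]]]] := fp_presents_tensor Nfp.
  have [_ sA] := Se A; have [SB sB] := Se B; have [SC sC] := Se C.
  move=> t; have [v <-] := sB t; rewrite tensor_map_tvec; split.
    move=> /SC[w]; have [u <-] := act_lift w gs.
    rewrite -act_vmap => /eqP; rewrite eq_sym -subr_eq0 -vmapB => /eqP.
    move=> /(vmap_exact fg)[z fz]; exists (tvec e z).
    rewrite tensor_map_tvec fz; apply/eqP; rewrite -subr_eq0; apply/eqP.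
    by rewrite tvecB (SB (act S u)).2 ?subr0 ?subrr //; exists u.
  rewrite -tensor_map_tvec => -[s]; have [u <-] := sA s; rewrite tensor_map_tvec => <-.
  by rewrite tensor_map_tvec ((vmap_exact fg _).2 _) ?raddf0 //; exists u.
move=> t; have [m [n [S [e Se]]]] := fp_presents_tensor Nfp.
have [_ sB] := Se B; have [_ sC] := Se C.
have [w <-] := sC t; have [v <-] := act_lift w gs.
by exists (tvec e v); rewrite tensor_map_tvec.
Qed.

End Purity.

(** * Character modules of finitely presented modules are pure-injective *)
Section MatrixCharacters.
Variables (R : pzRingType) (m n : nat) (S : 'M[R^c]_(m, n)).
Local Notation N := (matrix_module S).
Local Notation e := (matrix_gen S).
Local Notation pi := (lcoker_pi (matrix_map S)).

Lemma matrix_gen_sum (u : 'rV[R^c]_n) : \sum_k u 0 k *: e k = pi u.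
Proof.
rewrite {2}[u]row_sum_delta linear_sum; apply: eq_bigr => k _.
by rewrite linearZ.
Qed.

Definition gen_pairing (f : {ffun 'I_n -> dual N}) : QZ := \sum_k f k (e k).

Lemma gen_pairing_act (w : {ffun 'I_m -> dual N}) : gen_pairing (act S w) = 0.
Proof.
rewrite /gen_pairing; under eq_bigr => k _ do rewrite ffunE dual_sum.
rewrite exchange_big big1 // => i _; under eq_bigr => k _ do rewrite dualZ.
rewrite -raddf_sum; have -> : \sum_k S i k *: e k = pi (row i S).
  by rewrite -matrix_gen_sum; apply: eq_bigr => k _; rewrite mxE.
rewrite (_ : pi _ = 0) ?raddf0 //; apply/(lcoker_exact (matrix_map S)).
by exists (delta_mx 0 i); rewrite rowE.
Qed.

Lemma gen_pairingD f g : gen_pairing (f + g) = gen_pairing f + gen_pairing g.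
Proof.
by rewrite /gen_pairing -big_split; apply: eq_bigr => k _; rewrite ffunE.
Qed.

Lemma gen_pairingB f g : gen_pairing (f - g) = gen_pairing f - gen_pairing g.
Proof.
by rewrite /gen_pairing -sumrB; apply: eq_bigr => k _; rewrite !ffunE dualB.
Qed.

Lemma gen_pairing0 : gen_pairing 0 = 0.
Proof. by apply: big1 => k _; rewrite ffunE. Qed.

(** The pairing recovers the values of a character outside the generators. *)
Lemma gen_pairing_pi (f : dual N) (u : 'rV[R^c]_n) :
  gen_pairing [ffun k => (u 0 k : R) *: f] = f (pi u).
Proof.
rewrite -matrix_gen_sum raddf_sum; apply: eq_bigr => k _.
by rewrite ffunE dualZ.
Qed.

(** The adjunction between N (x) M -> Q/Z and M -> Hom(N, Q/Z), with N (x) M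
    replaced by M^n modulo S M^m. *)
Lemma functional_to_dual (M : lmodType R) (h : {additive {ffun 'I_n -> M} -> QZ}) :
    (forall w, h (act S w) = 0) ->
  exists f : {linear M -> dual N}, forall v, gen_pairing (vmap f v) = h v.
Proof.
move=> hS; pose sc (u : 'rV[R^c]_n) (x : M) : {ffun 'I_n -> M} :=
  [ffun k => (u 0 k : R) *: x].
have [|f f0|r x f y g fE gE|f fE] := @linear_of_graph R M (dual N)
    (fun x f => forall u, f (pi u) = h (sc u x)).
- move=> x; pose g u := h (sc u x).
  have gB : zmod_morphism g.
    move=> u u'; rewrite /g -raddfB; congr (h _).
    by apply/ffunP=> k; rewrite !ffunE !mxE scalerBl.
  have [|u|f fE] := @additive_factor _ _ _ pi (additive_pack gB).
  + exact: lcoker_pi_surj.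
  + move=> /(lcoker_exact (matrix_map S))[c <-] /=.
    by rewrite /g /sc -act_smul hS.
  + by exists f.
- apply: additive_ext => x; have [u <-] := lcoker_pi_surj x.
  rewrite f0 (_ : sc u 0 = 0) ?raddf0 //.
  by apply/ffunP=> k; rewrite !ffunE scaler0.
- move=> u; rewrite dualD dualZ -linearZ fE gE -raddfD; congr (h _).
  by apply/ffunP=> k; rewrite !ffunE mxE scalerDr scalerA.
exists f => v; rewrite /gen_pairing.
under eq_bigr => k _ do rewrite ffunE fE.
rewrite -raddf_sum; congr (h _); apply/ffunP=> k.
rewrite sum_ffunE (bigD1 k) //= big1 => [|j jk].
  by rewrite ffunE mxE !eqxx scale1r addr0.
by rewrite ffunE mxE eqxx eq_sym (negPf jk) scale0r.
Qed.

Lemma dual_eqP (f g : dual N) :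
  (forall u : 'rV[R^c]_n, gen_pairing [ffun k => (u 0 k : R) *: f] =
                          gen_pairing [ffun k => (u 0 k : R) *: g]) -> f = g.
Proof.
move=> fg; apply: additive_ext => x; have [u <-] := lcoker_pi_surj x.
by rewrite -!gen_pairing_pi fg.
Qed.

(** By adjunction g is a functional on A^n that kills S A^m.  Because f reflects
    systems, it is well defined on the subgroup f(A^n) + S B^m of B^n when
    extended by 0 to S B^m, and it extends to B^n by injectivity of Q/Z. *)
Lemma dual_extends (A B : lmodType R) (f : {linear A -> B})
    (g : {linear A -> dual N}) :
  reflects_systems f -> exists h : {linear B -> dual N}, forall a, h (f a) = g a.
Proof.
move=> fS; have [|||c cP] := @QZ_extension {ffun 'I_n -> B}
  (fun b d => exists v w, b = vmap f v + act S w /\ d = gen_pairing (vmap g v)).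
- by exists 0, 0; rewrite !vmap0 act0 addr0 gen_pairing0.
- move=> _ _ _ _ [v [w [-> ->]]] [v' [w' [-> ->]]]; exists (v - v'), (w - w').
  by rewrite !vmapB actB gen_pairingB opprD addrACA.
- move=> _ [v [w [/eqP + ->]]]; rewrite eq_sym addr_eq0 => /eqP vE.
  have [|z <-] := fS _ _ S v (- w); last by rewrite act_vmap gen_pairing_act.
  by rewrite vE actN.
have cf v : c (vmap f v) = gen_pairing (vmap g v).
  by apply: cP; exists v, 0; rewrite act0 addr0.
have [w|h hP] := @functional_to_dual B c.
  by apply: cP; exists 0, w; rewrite !vmap0 add0r gen_pairing0.
exists h => a; apply: dual_eqP => u.
have sc (k : {linear A -> dual N}) : [ffun j => (u 0 j : R) *: k a] =
    vmap k [ffun j => (u 0 j : R) *: a].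
  by apply/ffunP=> j; rewrite !ffunE linearZ.
rewrite sc -cf -hP; congr gen_pairing.
by apply/ffunP=> j; rewrite !ffunE !linearZ.
Qed.

Lemma dual_separates (M : lmodType R) (v : {ffun 'I_n -> M}) :
    ~ (exists w, act S w = v) ->
  exists f : {linear M -> dual N}, gen_pairing (vmap f v) != 0.
Proof.
move=> /(@QZ_separation {ffun 'I_n -> M} (fun v => exists w, act S w = v))[||h hS hv].
- by exists 0; rewrite act0.
- by move=> _ _ [v1 <-] [v2 <-]; exists (v1 - v2); rewrite actB.
have [w|f fP] := @functional_to_dual M h; first by apply: hS; exists w.
by exists f; rewrite fP.
Qed.

End MatrixCharacters.

Section DualDivisibility.
Variables (R : pzRingType) (N : lmodType R^c) (m n : nat) (S : 'M[R^c]_(m, n)).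

(** Dual to the exact sequence Hom(N_S, N) -> N^n -> N^m given by S: a functional
    on N^n that kills the kernel of N^n -> N^m factors through N^m, as Q/Z is
    injective. *)
Lemma dual_act_solvable (t : {ffun 'I_n -> dual N}) :
    (forall x : {ffun 'I_n -> N}, (forall i, \sum_k S i k *: x k = 0) ->
       \sum_k t k (x k) = 0) ->
  exists z, act S z = t.
Proof.
move=> tS; have [|||h hP] := @QZ_extension {ffun 'I_m -> N} (fun y d =>
  exists x : {ffun 'I_n -> N},
    y = [ffun i => \sum_k S i k *: x k] /\ d = \sum_k t k (x k)).
- exists 0; split; last by rewrite big1 // => k _; rewrite ffunE raddf0.
  by apply/ffunP=> i; rewrite !ffunE big1 // => k _; rewrite ffunE scaler0.
- move=> _ _ _ _ [x [-> ->]] [x' [-> ->]]; exists (x - x').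
  split; last by rewrite -sumrB; apply: eq_bigr => k _; rewrite !ffunE raddfB.
  apply/ffunP=> i; rewrite !ffunE -sumrB; apply: eq_bigr => k _.
  by rewrite !ffunE scalerBr.
- move=> _ [x [x0 ->]]; apply: tS => i.
  by move/ffunP/(_ i): x0; rewrite !ffunE.
pose d l (i : 'I_l) (x : N) : {ffun 'I_l -> N} := [ffun j => if j == i then x else 0].
have dB i : zmod_morphism (fun x => h (d m i x)).
  move=> x y; rewrite -raddfB; congr (h _); apply/ffunP=> j.
  by rewrite !ffunE; case: eqP; rewrite ?subrr.
exists [ffun i => additive_pack (dB i)]; apply/ffunP=> k.
apply: additive_ext => x; rewrite ffunE dual_sum.
under eq_bigr => i _ do rewrite dualZ ffunE /=.
rewrite -raddf_sum; transitivity (\sum_j t j (d n k x j)).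
  apply: hP; exists (d n k x); split=> //; apply/ffunP=> i.
  rewrite sum_ffunE ffunE (bigD1 i) //= big1 => [|j ji]; last first.
    by rewrite ffunE eq_sym (negPf ji).
  rewrite (bigD1 k) //= big1 => [|j jk]; last first.
    by rewrite ffunE (negPf jk) scaler0.
  by rewrite !ffunE !eqxx.
rewrite (bigD1 k) //= big1 => [|j jk]; last by rewrite ffunE (negPf jk) raddf0.
by rewrite ffunE eqxx addr0.
Qed.

End DualDivisibility.

(** * Enough pure-injective modules *)
Section EnoughPureInjectives.
Variable R : pzRingType.

Lemma lcoker_short_exact (A B : lmodType R) (f : {linear A -> B}) :
  injective f -> short_exact f (lcoker_pi f).
Proof.
by split=> //; [exact: lcoker_exact | exact: lcoker_pi_surj].
Qed.

Lemma reflects_systems_pure_exact (A B : lmodType R) (f : {linear A -> B}) :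
  reflects_systems f -> pure_exact f (lcoker_pi f).
Proof.
move=> fS; apply/pure_exactP; split=> //.
exact/lcoker_short_exact/reflects_systems_inj.
Qed.

Lemma pure_monoP (A B : lmodType R) (f : {linear A -> B}) :
  pure_mono f <-> reflects_systems f.
Proof.
split=> [[C [g /pure_exactP[]]] //|/reflects_systems_pure_exact fg].
by exists (lcoker f), (lcoker_pi f).
Qed.

Lemma pure_injectiveP (U : lmodType R) :
  pure_injective U <->
  forall (A B : lmodType R) (f : {linear A -> B}), reflects_systems f ->
    forall g : {linear A -> U}, exists h : {linear B -> U}, h \o f =1 g.
Proof.
split=> [Upi A B f /reflects_systems_pure_exact/Upi[_ _ fU] g|Upi A B C f g].
  by have [h <-] := fU g; exists h.
case/pure_exactP=> -[fi fg gs] fS; split.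
- move=> h k hk; apply: linear_ext => c; have [b <-] := gs c.
  by rewrite -[h _]/(precomp g h b) hk.
- move=> h; split=> [hf|[k <-]].
    have [b /fg[a <-]|k kP] := @linear_factor R B C U g h gs.
      by rewrite -[h _]/(precomp f h a) hf.
    by exists k; apply: linear_ext.
  apply: linear_ext => a; rewrite /precomp /comp_lin /=.
  by rewrite (_ : g (f a) = 0) ?linear0 //; apply/fg; exists a.
- by move=> h; have [k kP] := Upi _ _ f fS h; exists k; apply: linear_ext.
Qed.

Lemma dual_pure_injective m n (S : 'M[R^c]_(m, n)) :
  pure_injective (dual (matrix_module S) : lmodType R).
Proof.
apply/pure_injectiveP => A B f fS g.
by have [h hf] := dual_extends g fS; exists h.
Qed.

Lemma dprod_pure_injective (I : Type) (U : I -> lmodType R) :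
  (forall i, pure_injective (U i)) -> pure_injective (dprod U : lmodType R).
Proof.
move=> UP; apply/pure_injectiveP => A B f fS g.
have ext i : {h : {linear B -> U i} | forall a, h (f a) = g a i}.
  have /pure_injectiveP/(_ _ _ _ fS (comp_lin (dprod_proj U i) g)) := UP i.
  by case/cid=> h hP; exists h => a; apply: hP.
have [k kP] := dprod_lift (fun i => sval (ext i)); exists k => a.
by apply: functional_extensionality_dep => i; rewrite /= kP (svalP (ext i)).
Qed.

Section Envelope.
Variable M : lmodType R.

(** The index type of the envelope: all maps M -> Hom(N, Q/Z) with N the cokernel
    of a matrix.  Ranging over matrices rather than modules N keeps it small. *)
Record matrix_character := MatrixCharacter {
  char_rows : nat;
  char_cols : nat;
  char_matrix : 'M[R^c]_(char_rows, char_cols);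
  char_map : {linear M -> dual (matrix_module char_matrix)}
}.

Definition char_dual (c : matrix_character) : lmodType R :=
  dual (matrix_module (char_matrix c)).

Definition envelope : lmodType R := dprod char_dual.

Lemma envelope_pure_injective : pure_injective envelope.
Proof. by apply: dprod_pure_injective => c; apply: dual_pure_injective. Qed.

(** A vector of M^n outside S M^m is detected by some map from M to the character
    module of S, which is one of the coordinates of the envelope; pairings with
    the generators vanish on S times anything. *)
Lemma envelope_embedding : exists2 u : {linear M -> envelope},
  reflects_systems u & forall x c, u x c = char_map c x.
Proof.
have [u uP] := dprod_lift (fun c => char_map c : {linear M -> char_dual c}).
exists u => // m n S v w wv; apply: contrapT => /dual_separates[f /eqP]; apply.
pose c := MatrixCharacter f.
rewrite -(gen_pairing_act (vmap (dprod_proj _ c) w)) -act_vmap wv.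
by congr gen_pairing; apply/ffunP=> k; rewrite !ffunE; rewrite -[RHS]/(u (v k) c) uP.
Qed.

End Envelope.

Lemma tensor_map_comp (N : lmodType R^c) (A B C : lmodType R)
    (f : {linear A -> B}) (g : {linear B -> C}) (h : {linear A -> C}) :
  g \o f =1 h -> tensor_map N g \o tensor_map N f =1 tensor_map N h.
Proof.
move=> gf; apply: tensor_ind => [|s t /= es et|x m /=].
- by rewrite /= !raddf0.
- by rewrite !raddfB /= es et.
- by rewrite !tensor_map_tens -gf.
Qed.

Lemma exact_comp_inj (A B C D : zmodType) (f : A -> B) (g : B -> C)
    (w : {additive C -> D}) :
  exact_at f g -> injective w -> exact_at f (w \o g).
Proof.
move=> fg wi b; rewrite -fg /=; split=> [wg|->]; last exact: raddf0.
by apply: wi; rewrite raddf0.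
Qed.

Lemma pi_copresentation_exists (M : lmodType R) :
  exists (U V : lmodType R) (u : {linear M -> U}) (v : {linear U -> V}),
    pi_copresentation u v.
Proof.
have [u uS _] := envelope_embedding M; pose p := lcoker_pi u.
have [w wS _] := envelope_embedding (lcoker u).
have up : pure_exact u p by apply: reflects_systems_pure_exact.
have wi := reflects_systems_inj wS; have [[ui upe ps] upN] := up.
exists (envelope M), (envelope (lcoker u)), u, (comp_lin w p); split.
- by split; apply: envelope_pure_injective.
- by split=> //; apply: (@exact_comp_inj _ _ _ _ u p w).
- move=> N Nfp; have [uNi uNp _] := upN N Nfp; split=> // t.
  rewrite -(tensor_map_comp (f := p) (g := w)) //.
  apply: (@exact_comp_inj _ _ _ _ _ _ (tensor_map N w) uNp).
  exact: (reflects_systems_tensor w).1.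
- exact/pure_monoP.
- by exists (lcoker u), p, w; split=> //; apply/pure_monoP.
Qed.

End EnoughPureInjectives.

(** * Modules given by generators and relations *)
Section PresentedModule.
Variables (R : pzRingType) (X : Type).

Inductive term :=
  | Gen of X
  | Zero
  | Opp of term
  | Add of term & term
  | Scale of R & term.

HB.instance Definition _ := gen_eqMixin term.
HB.instance Definition _ := gen_choiceMixin term.

Fixpoint eval (M : lmodType R) (v : X -> M) (t : term) : M :=
  match t with
  | Gen x => v x
  | Zero => 0
  | Opp s => - eval v s
  | Add s u => eval v s + eval v u
  | Scale r s => r *: eval v s
  end.

Lemma eval_linear (M M' : lmodType R) (f : {linear M -> M'}) (v : X -> M) t :
  eval (f \o v) t = f (eval v t).
Proof.
elim: t => //= [|s ->|s -> u ->|r s ->]; first by rewrite linear0.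
- by rewrite linearN.
- by rewrite linearD.
- by rewrite linearZ.
Qed.

Lemma eval_sum (M : lmodType R) (v : X -> M) (I : Type) (s : seq I)
    (F : I -> term) :
  eval v (\big[Add/Zero]_(i <- s) F i) = \sum_(i <- s) eval v (F i).
Proof. exact: (big_morph (eval v)). Qed.

Variable E : term -> Prop.

Definition satisfies (M : lmodType R) (v : X -> M) : Prop :=
  forall t, E t -> eval v t = 0.

(** Two terms are identified when they take the same value in every model of the
    relations.  This is the congruence generated by the module axioms and E,
    and all the module axioms are inherited from the models. *)
Definition term_equiv : rel term := fun s t =>
  `[< forall (M : lmodType R) (v : X -> M), satisfies v -> eval v s = eval v t >].

Lemma term_equiv_class : equiv_class_of term_equiv.
Proof.
split=> [s|s t|t s u].
- exact/asboolP.
- by apply/asboolP/asboolP => st M v vE; rewrite st.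
- move=> /asboolP st /asboolP tu; apply/asboolP => M v vE.
  by rewrite st // tu.
Qed.

Canonical term_equivRel := EquivRelPack term_equiv_class.

Definition presented : Type := {eq_quot term_equivRel}.
HB.instance Definition _ := Choice.on presented.

Definition tpi (t : term) : presented := \pi_({eq_quot term_equivRel}) t.

Lemma tpiP s t : tpi s = tpi t <->
  (forall (M : lmodType R) (v : X -> M), satisfies v -> eval v s = eval v t).
Proof.
by split=> [/eqquotP/asboolP //|st]; apply/eqquotP/asboolP.
Qed.

Definition trepr (p : presented) : term := repr (p : {eq_quot term_equivRel}).

Lemma treprK p : tpi (trepr p) = p.
Proof. exact: reprK. Qed.

Lemma eval_trepr_tpi (M : lmodType R) (v : X -> M) t :
  satisfies v -> eval v (trepr (tpi t)) = eval v t.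
Proof. by move=> vE; have /tpiP := treprK (tpi t); apply. Qed.

Definition presented_add p q := tpi (Add (trepr p) (trepr q)).
Definition presented_opp p := tpi (Opp (trepr p)).
Definition presented_scale r p := tpi (Scale r (trepr p)).

Lemma presented_addA : associative presented_add.
Proof.
by move=> p q s; apply/tpiP=> M v vE /=; rewrite !eval_trepr_tpi //= addrA.
Qed.

Lemma presented_addC : commutative presented_add.
Proof. by move=> p q; apply/tpiP=> M v vE /=; rewrite addrC. Qed.

Lemma presented_add0 : left_id (tpi Zero) presented_add.
Proof.
move=> p; rewrite -[RHS]treprK; apply/tpiP=> M v vE /=.
by rewrite eval_trepr_tpi //= add0r.
Qed.

Lemma presented_addN : left_inverse (tpi Zero) presented_opp presented_add.
Proof.
by move=> p; apply/tpiP=> M v vE /=; rewrite eval_trepr_tpi //= addNr.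
Qed.

HB.instance Definition _ := GRing.isZmodule.Build presented
  presented_addA presented_addC presented_add0 presented_addN.

Lemma presented_scaleA r s p :
  presented_scale r (presented_scale s p) = presented_scale (r * s) p.
Proof. by apply/tpiP=> M v vE /=; rewrite eval_trepr_tpi //= scalerA. Qed.

Lemma presented_scale1 : left_id 1 presented_scale.
Proof.
by move=> p; rewrite -[RHS]treprK; apply/tpiP=> M v vE /=; rewrite scale1r.
Qed.

Lemma presented_scaleDr : right_distributive presented_scale +%R.
Proof.
by move=> r p q; apply/tpiP=> M v vE /=; rewrite !eval_trepr_tpi //= scalerDr.
Qed.

Lemma presented_scaleDl p : {morph presented_scale^~ p : r s / r + s}.
Proof.
by move=> r s; apply/tpiP=> M v vE /=; rewrite !eval_trepr_tpi //= scalerDl.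
Qed.

HB.instance Definition _ := GRing.Zmodule_isLmodule.Build R presented
  presented_scaleA presented_scale1 presented_scaleDr presented_scaleDl.

Definition presented_gen (x : X) : presented := tpi (Gen x).

Lemma eval_presented_gen t : eval presented_gen t = tpi t.
Proof.
elim: t => //= [s ->|s -> u ->|r s ->]; apply/tpiP=> M v vE /=;
  by rewrite !eval_trepr_tpi.
Qed.

Lemma presented_gen_satisfies : satisfies presented_gen.
Proof.
by move=> t Et; rewrite eval_presented_gen; apply/tpiP=> M v /(_ t Et).
Qed.

Lemma presented_lift (M : lmodType R) (v : X -> M) : satisfies v ->
  exists f : {linear presented -> M}, forall x, f (presented_gen x) = v x.
Proof.
move=> vE; pose f p := eval v (trepr p).
have fP : linear f by move=> r p q; rewrite /f !eval_trepr_tpi //= eval_trepr_tpi.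
by exists (linear_pack fP) => x; apply: eval_trepr_tpi.
Qed.

Lemma presented_ext (M : lmodType R) (f g : {linear presented -> M}) :
  (forall x, f (presented_gen x) = g (presented_gen x)) -> f = g.
Proof.
move=> fg; apply: linear_ext => p; rewrite -[p]treprK -eval_presented_gen.
rewrite -!eval_linear; congr eval; exact/funext.
Qed.

End PresentedModule.

(** * Natural transformations from the kernel of - (x) X -> - (x) Y *)
Section KernelPoints.
Variables (R : pzRingType) (X Y : lmodType R) (f : {linear X -> Y}).

(** A matrix S presenting N and a vector representing an element of N (x) X whose
    image in N (x) Y is zero. *)
Record kpoint := KPoint {
  rows : nat;
  cols : nat;
  system : 'M[R^c]_(rows, cols);
  kvec : {ffun 'I_cols -> X};
  kvecP : exists y, act system y = vmap f kvec
}.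

(** The relations of the kernel functor K.  A matrix B with S1 B = C S for some C
    induces a morphism N_S1 -> N_S, and the last field says that the point over
    tgt is the sum of the images of the other two in N (x) X.  Functoriality and
    additivity are both instances. *)
Record krelation := KRelation {
  src1 : kpoint;
  src2 : kpoint;
  tgt : kpoint;
  lcoef : 'M[R^c]_(cols src1, cols tgt);
  rcoef : 'M[R^c]_(cols src2, cols tgt);
  lcoefP : exists C, system src1 *m lcoef = C *m system tgt;
  rcoefP : exists C, system src2 *m rcoef = C *m system tgt;
  krelationP : exists w, kvec tgt =
    act lcoef (kvec src1) + act rcoef (kvec src2) + act (system tgt) w
}.

Section Families.
Variable M : lmodType R.

Definition kfamily := forall i : kpoint, {ffun 'I_(cols i) -> M}.
Implicit Types s t : kfamily.

Definition compatible t : Prop := forall j : krelation, exists w,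
  t (tgt j) = act (lcoef j) (t (src1 j)) + act (rcoef j) (t (src2 j)) +
              act (system (tgt j)) w.

Definition negligible t : Prop := forall i, exists w, act (system i) w = t i.

End Families.

Lemma compatible_map (M M' : lmodType R) (g : {linear M -> M'}) (t : kfamily M) :
  compatible t -> compatible (fun i => vmap g (t i)).
Proof.
move=> tP j; have [w ->] := tP j; exists (vmap g w).
by rewrite !vmapD !act_vmap.
Qed.

(** Compatibility with the relation i = 0 i + 0 i. *)
Lemma compatible_negligible (U : lmodType R) (t : kfamily U) (i : kpoint) :
    compatible t -> (exists w, act (system i) w = kvec i) ->
  exists w, act (system i) w = t i.
Proof.
move=> tP [w wi]; pose O : 'M[R^c]_(cols i, cols i) := 0.
have C0 : exists C : 'M[R^c]_(rows i, rows i), system i *m O = C *m system i.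
  by exists 0; rewrite mul0mx mulmx0.
have j0 : exists w0, kvec i =
    act O (kvec i) + act O (kvec i) + act (system i) w0.
  by exists w; rewrite !act0mx !add0r.
have [z] := tP (KRelation C0 C0 j0); rewrite /= !act0mx !add0r => ->.
by exists z.
Qed.

(** U -> P, with P the pushout of f along h, reflects systems: if (0, v) equals
    S w - (f x, - h x) for some x in X^n, then f x lies in S Y^m, so h x lies in
    S U^m by hypothesis, and so does v.  Composing Y -> P with a retraction of
    U -> P gives the factorization. *)
Lemma kernel_point_factor (U : lmodType R) (h : {linear X -> U}) :
    pure_injective U -> negligible (fun i => vmap h (kvec i)) ->
  exists g : {linear Y -> U}, g \o f =1 h.
Proof.
move=> UP hP; pose YU : lmodType R := (Y * U)%type.
have kL : linear (fun x => (f x, - h x) : YU).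
  by move=> r x y; congr pair; rewrite linearP ?opprD -?scalerN.
pose k := linear_pack kL; pose p := lcoker_pi k.
have iL : linear (fun u => (0, u) : YU).
  by move=> r x y; congr pair; rewrite /= ?scaler0 ?addr0.
have jL : linear (fun y => (y, 0) : YU).
  by move=> r x y; congr pair; rewrite /= ?scaler0 ?addr0.
have fstL : linear (fun z : YU => z.1) by [].
have sndL : linear (fun z : YU => z.2) by [].
have inS : reflects_systems (comp_lin p (linear_pack iL)).
  move=> m n S v w wv; have [w' w'w] := act_lift w (@lcoker_pi_surj _ _ _ k).
  pose v' := vmap (linear_pack iL) v.
  have /(vmap_exact (@lcoker_exact _ _ _ k)) [x xv] : vmap p (act S w' - v') = 0.
    rewrite vmapB act_vmap w'w wv; apply/ffunP=> l.
    by rewrite !ffunE subrr.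
  have fx : act S (vmap (linear_pack fstL) w') = vmap f x.
    rewrite -act_vmap; move/(congr1 (vmap (linear_pack fstL))): xv.
    rewrite vmapB => /ffunP xv; apply/ffunP=> l; have := xv l.
    by rewrite !ffunE /= subr0.
  have hx : act S (vmap (linear_pack sndL) w') = v - vmap h x.
    rewrite -act_vmap; move/(congr1 (vmap (linear_pack sndL))): xv.
    rewrite vmapB => /ffunP xv; apply/ffunP=> l; have := xv l.
    by rewrite !ffunE /= => ->; rewrite addrC subrK.
  have [z zP] := hP (@KPoint m n S x (ex_intro _ _ fx)).
  by exists (vmap (linear_pack sndL) w' + z); rewrite actD hx zP subrK.
have [r rP] := (pure_injectiveP U).1 UP _ _ _ inS (id_lin U).
exists (comp_lin r (comp_lin p (linear_pack jL))) => x.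
rewrite -[RHS](rP (h x)); congr (r _).
apply/subr0_eq; rewrite -[LHS](linearB p); apply/(lcoker_exact k); exists x.
by congr pair; rewrite /= ?subr0 ?sub0r.
Qed.

(** A transformation t from K to - (x) N^+, with N^+ the character module of N,
    gives at N a functional K(N) -> N (x) N^+ -> Q/Z.  It extends to N (x) X, that
    is, to a map h : X -> N^+.  The transformations h and t agree, because an
    element of N' (x) N^+ is zero as soon as its images under all maps N' -> N
    have pairing zero (dual_act_solvable). *)
Lemma family_extend_dual m n (S : 'M[R^c]_(m, n))
    (t : kfamily (dual (matrix_module S) : lmodType R)) :
  compatible t -> exists h : {linear X -> dual (matrix_module S)},
    negligible (fun i => vmap h (kvec i) - t i).
Proof.
move=> tP.
have negl x p w : act S w = x -> gen_pairing (t (@KPoint m n S x p)) = 0.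
  move=> wx; have [z <-] : exists z, act S z = t (@KPoint m n S x p).
    by apply: (compatible_negligible (i := @KPoint m n S x p) tP); exists w.
  exact: gen_pairing_act.
have [|||h hP] := @QZ_extension {ffun 'I_n -> X}
  (fun x d => exists p, d = gen_pairing (t (@KPoint m n S x p))).
- have p : exists y, act S y = vmap f (0 : {ffun 'I_n -> X}).
    by exists 0; rewrite act0 vmap0.
  by exists p; rewrite (negl _ _ 0) ?act0.
- move=> x _ x' _ [p ->] [p' ->].
  have q : exists y, act S y = vmap f (x - x').
    have [[y yP] [y' y'P]] := (p, p'); exists (y - y').
    by rewrite actB yP y'P vmapB.
  exists q.
  have C1 : exists C, S *m 1%:M = C *m S by exists 1%:M; rewrite mul1mx mulmx1.
  have C2 : exists C, S *m - 1%:M = C *m S.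
    by exists (- 1%:M); rewrite mulmxN mulNmx mul1mx mulmx1.
  have xx' : exists w, x - x' = act 1%:M x + act (- 1%:M : 'M[R^c]_n) x' + act S w.
    by exists 0; rewrite actNmx !act1 act0 addr0.
  have [w /= ->] := tP (@KRelation (KPoint p) (KPoint p') (KPoint q) _ _ C1 C2 xx').
  by rewrite actNmx !act1 gen_pairingD gen_pairing_act addr0 gen_pairingB.
- by move=> d [p ->]; rewrite (negl _ _ 0) ?act0.
have hp x p : h x = gen_pairing (t (@KPoint m n S x p)) by apply: hP; exists p.
have [w|g gP] := @functional_to_dual R m n S X h.
  have p : exists y, act S y = vmap f (act S w).
    by exists (vmap f w); rewrite act_vmap.
  by rewrite (hp _ p) (negl _ _ w).
exists g => i; apply: dual_act_solvable => x x0.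
(* B is the matrix of the map N_(system i) -> N with e_k |-> x_k. *)
have [u uP] := choice (@lcoker_pi_surj _ _ _ (matrix_map S)).
pose B : 'M[R^c]_(cols i, n) := \matrix_k u (x k).
have xB (F : {ffun 'I_(cols i) -> dual (matrix_module S)}) :
    \sum_k F k (x k) = gen_pairing (act B F).
  rewrite /gen_pairing; under [RHS]eq_bigr => l _ do rewrite ffunE dual_sum.
  rewrite exchange_big; apply: eq_bigr => k _; under eq_bigr => l _ do rewrite dualZ.
  rewrite -{1}[x k]uP -matrix_gen_sum raddf_sum; apply: eq_bigr => l _.
  by rewrite mxE.
have CP : exists C, system i *m B = C *m S.
  have /choice[c cP] k : exists c, c *m S = row k (system i *m B).
    apply/(lcoker_exact (matrix_map S)).
    rewrite -[RHS](x0 k) row_mul mulmx_sum_row linear_sum.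
    by apply: eq_bigr => l _; rewrite linearZ /= rowK mxE; congr (_ *: _); apply: uP.
  by exists (\matrix_k c k); apply/row_matrixP=> k; rewrite [RHS]row_mul rowK cP.
have C0 : exists C, system i *m 0 = C *m S by exists 0; rewrite mul0mx mulmx0.
have q : exists y, act S y = vmap f (act B (kvec i)).
  have [[C CB] [y yi]] := (CP, kvecP i); exists (act C y).
  by rewrite act_mul -CB -act_mul yi act_vmap.
have qi : exists w, act B (kvec i) =
   act B (kvec i) + act (0 : 'M[R^c]_(cols i, n)) (kvec i) + act S w.
  by exists 0; rewrite act0mx act0 !addr0.
have [w /= tq] := tP (@KRelation i i (KPoint q) _ _ CP C0 qi).
rewrite xB actB gen_pairingB -act_vmap gP (hp _ q) tq act0mx addr0.
by rewrite gen_pairingD gen_pairing_act addr0 subrr.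
Qed.

(** Apply the previous lemma to each coordinate of the envelope of U, and compose
    with a retraction of U -> envelope U. *)
Lemma family_extend (U : lmodType R) (t : kfamily U) :
    pure_injective U -> compatible t ->
  exists h : {linear X -> U}, negligible (fun i => vmap h (kvec i) - t i).
Proof.
move=> UP tP; have [u uS uE] := envelope_embedding U.
have ext c := cid (family_extend_dual (compatible_map (char_map c) tP)).
have [h hE] := dprod_lift (fun c => sval (ext c) : {linear X -> char_dual c}).
have [r rP] := (pure_injectiveP U).1 UP _ _ _ uS (id_lin U).
exists (comp_lin r h) => i; have z c := cid (svalP (ext c) i).
pose w : {ffun 'I_(rows i) -> envelope U} := [ffun k => fun c => sval (z c) k].
exists (vmap r w); suff e : act (system i) w = vmap h (kvec i) - vmap u (t i).
  rewrite -act_vmap e vmapB; congr (_ - _).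
    by apply/ffunP=> k; rewrite !ffunE.
  by apply/ffunP=> k; rewrite !ffunE; apply: rP.
apply/ffunP=> k; apply: functional_extensionality_dep => c.
have /ffunP/(_ k) := svalP (z c); rewrite !ffunE => zP.
transitivity (sval (ext c) (kvec i k) - char_map c (t i k)).
  rewrite -zP -[LHS]/(dprod_proj _ c (\sum_l _)) linear_sum.
  by apply: eq_bigr => l _; rewrite linearZ ffunE.
by rewrite -[RHS]/(h (kvec i k) c - u (t i k) c) hE uE.
Qed.

End KernelPoints.

(** * The cokernel of a map between representable functors *)
Section CokernelFunctor.
Variables (R : pzRingType) (A B : lmodType R) (d : {linear A -> B}).

Lemma precomp_is_zmod_morphism (M : lmodType R) :
  zmod_morphism (fun h : hom_functor B M => precomp d h : hom_functor A M).
Proof. by move=> h k; apply: linear_ext. Qed.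

Definition precomp_add (M : lmodType R) :
    {additive hom_functor B M -> hom_functor A M} :=
  additive_pack (@precomp_is_zmod_morphism M).

Definition coker_obj (M : lmodType R) : zmodType := coker (precomp_add M).

Definition coker_class (M : lmodType R) : {additive hom_functor A M -> coker_obj M} :=
  coker_pi (precomp_add M).

Lemma coker_class_surj (M : lmodType R) : surj (coker_class M).
Proof. exact: coker_pi_surj. Qed.

Definition coker_fmap_fun (M M' : lmodType R) (g : {linear M -> M'})
    (c : coker_obj M) : coker_obj M' :=
  coker_class M' (comp_lin g (repr c : {linear A -> M})).

Lemma coker_fmap_class (M M' : lmodType R) (g : {linear M -> M'})
    (h : {linear A -> M}) :
  coker_fmap_fun g (coker_class M h) = coker_class M' (comp_lin g h).
Proof.
apply/subr0_eq; rewrite -raddfB; apply/(coker_exact (precomp_add M')).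
set h' := repr _; have [k kP] : exists k, precomp_add M k = h' - h.
  apply/(coker_exact (precomp_add M)); rewrite raddfB; apply/eqP.
  by rewrite subr_eq0; apply/eqP/(reprK (coker_class M h)).
exists (comp_lin g k); apply: linear_ext => a.
rewrite -[RHS](raddfB g); congr (g _).
by rewrite -[LHS]/(precomp_add M k a) kP.
Qed.

Lemma coker_fmap_is_zmod_morphism (M M' : lmodType R) (g : {linear M -> M'}) :
  zmod_morphism (coker_fmap_fun g).
Proof.
move=> c c'; have [h <-] := coker_class_surj c; have [h' <-] := coker_class_surj c'.
rewrite -raddfB !coker_fmap_class -raddfB; congr (coker_class _ _).
by apply: linear_ext => a; rewrite /= raddfB.
Qed.

Definition coker_fmap (M M' : lmodType R) (g : {linear M -> M'}) :
    {additive coker_obj M -> coker_obj M'} :=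
  additive_pack (coker_fmap_is_zmod_morphism g).

Lemma coker_fmap_id (M : lmodType R) : coker_fmap (id_lin M) =1 id.
Proof.
move=> c; have [h <-] := coker_class_surj c; rewrite [LHS]coker_fmap_class.
by congr (coker_class _ _); apply: linear_ext.
Qed.

Lemma coker_fmap_comp (M M' M'' : lmodType R) (g : {linear M' -> M''})
    (f : {linear M -> M'}) :
  coker_fmap (comp_lin g f) =1 coker_fmap g \o coker_fmap f.
Proof.
move=> c; have [h <-] := coker_class_surj c.
rewrite [LHS]coker_fmap_class -[RHS]/(coker_fmap_fun g (coker_fmap_fun f _)).
by rewrite !coker_fmap_class; congr (coker_class _ _); apply: linear_ext.
Qed.

Lemma coker_fmap_add (M M' : lmodType R) (f g : {linear M -> M'}) :
  coker_fmap (f + g) =1 coker_fmap f \+ coker_fmap g.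
Proof.
move=> c; have [h <-] := coker_class_surj c.
rewrite [LHS]coker_fmap_class -[RHS]/(coker_fmap_fun f _ + coker_fmap_fun g _).
by rewrite !coker_fmap_class -raddfD; congr (coker_class _ _); apply: linear_ext.
Qed.

Definition coker_functor : functor R :=
  Functor coker_fmap_id coker_fmap_comp coker_fmap_add.

Lemma coker_functor_fp : finitely_presented coker_functor.
Proof.
have dN (M M' : lmodType R) (g : {linear M -> M'}) :
    precomp_add M' \o fmap (hom_functor B) g =1 fmap (hom_functor A) g \o precomp_add M.
  by move=> h; apply: linear_ext.
have cN (M M' : lmodType R) (g : {linear M -> M'}) :
    coker_class M' \o fmap (hom_functor A) g =1 fmap coker_functor g \o coker_class M.
  by move=> h; rewrite -[RHS]/(coker_fmap_fun g _) coker_fmap_class.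
exists A, B, (NatTrans dN), (@NatTrans _ (hom_functor A) coker_functor coker_class cN).
by move=> M; split; [apply: coker_exact | apply: coker_pi_surj].
Qed.

End CokernelFunctor.

(** * Modules representing compatible and negligible families *)
Section Representation.
Variables (R : pzRingType) (X Y : lmodType R) (f : {linear X -> Y}).
Local Notation I := (kpoint f).
Local Notation J := (krelation f).

(** The relations of both modules are the equations that say that a family T of
    terms is compatible, as witnessed by the solutions W. *)
Section Equations.
Variables (G : Type) (T : forall i : I, 'I_(cols i) -> term R G).
Variable W : forall j : J, 'I_(rows (tgt j)) -> term R G.

Definition act_term m n (S : 'M[R^c]_(m, n)) (w : 'I_m -> term R G) (k : 'I_n) :=
  \big[@Add R G/Zero R G]_(i < m) Scale (S i k : R) (w i).

Definition relation_term (j : J) (k : 'I_(cols (tgt j))) : term R G :=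
  Add (Add (Add (act_term (lcoef j) (@T (src1 j)) k)
                (act_term (rcoef j) (@T (src2 j)) k))
           (act_term (system (tgt j)) (@W j) k))
      (Opp (T k)).

Definition relations (s : term R G) : Prop := exists j k, s = @relation_term j k.

Lemma eval_act_term (M : lmodType R) (v : G -> M) m n (S : 'M[R^c]_(m, n))
    (w : 'I_m -> term R G) k :
  eval v (act_term S w k) = act S [ffun i => eval v (w i)] k.
Proof. by rewrite eval_sum ffunE; apply: eq_bigr => i _; rewrite /= ffunE. Qed.

Lemma satisfies_relations (M : lmodType R) (v : G -> M) :
  satisfies relations v <->
  forall j, [ffun k => eval v (T k)] =
    act (lcoef j) [ffun k => eval v (@T (src1 j) k)] +
    act (rcoef j) [ffun k => eval v (@T (src2 j) k)] +
    act (system (tgt j)) [ffun k => eval v (@W j k)].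
Proof.
split=> [vE j|vE _ [j [k ->]]].
  apply/ffunP=> k; rewrite [LHS]ffunE.
  have := vE _ (ex_intro _ j (ex_intro _ k erefl)).
  by rewrite /= !eval_act_term => /subr0_eq <-; rewrite !ffunE.
move/ffunP/(_ k): (vE j); rewrite [LHS]ffunE /= !eval_act_term => ->.
by rewrite !ffunE subrr.
Qed.

End Equations.

Definition param : Type := {j : J & 'I_(rows (tgt j))}.

Definition family_generator : Type := ({i : I & 'I_(cols i)} + param)%type.
Definition family_entry (i : I) (k : 'I_(cols i)) : term R family_generator :=
  Gen _ (inl (existT _ i k)).
Definition family_param (j : J) (k : 'I_(rows (tgt j))) : term R family_generator :=
  Gen _ (inr (existT _ j k)).

(** Maps out of this module are compatible families, together with the witnesses
    of their compatibility. *)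
Definition family_module : lmodType R :=
  presented (relations family_entry family_param).

Definition family_var (i : I) (k : 'I_(cols i)) : family_module :=
  presented_gen _ (inl (existT _ i k)).
Definition family_witness (j : J) (k : 'I_(rows (tgt j))) : family_module :=
  presented_gen _ (inr (existT _ j k)).

Definition negligible_generator : Type := ({i : I & 'I_(rows i)} + param)%type.
Definition negligible_entry (i : I) (k : 'I_(cols i)) : term R negligible_generator :=
  act_term (system i) (fun l => Gen _ (inl (existT _ i l))) k.
Definition negligible_param (j : J) (k : 'I_(rows (tgt j))) :
    term R negligible_generator :=
  Gen _ (inr (existT _ j k)).

(** Maps out of this module are families of the form act (system i) y_i, given by
    the y_i, together with witnesses of compatibility.  Keeping the witnesses
    makes the restriction along family_to_negligible hit every map whose family
    is negligible, and not only one map for each such family. *)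
Definition negligible_module : lmodType R :=
  presented (relations negligible_entry negligible_param).

Definition negligible_var (i : I) (l : 'I_(rows i)) : negligible_module :=
  presented_gen _ (inl (existT _ i l)).
Definition negligible_witness (j : J) (k : 'I_(rows (tgt j))) : negligible_module :=
  presented_gen _ (inr (existT _ j k)).

Lemma family_var_relations (j : J) : [ffun k => @family_var (tgt j) k] =
  act (lcoef j) [ffun k => @family_var (src1 j) k] +
  act (rcoef j) [ffun k => @family_var (src2 j) k] +
  act (system (tgt j)) [ffun k => @family_witness j k].
Proof.
by have /satisfies_relations :=
  @presented_gen_satisfies _ _ (relations family_entry family_param); apply.
Qed.

Definition negligible_value (i : I) : {ffun 'I_(cols i) -> negligible_module} :=
  act (system i) [ffun l => @negligible_var i l].

Lemma eval_negligible_entry (M : lmodType R) (v : negligible_generator -> M) i :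
  [ffun k => eval v (@negligible_entry i k)] =
  act (system i) [ffun l : 'I_(rows i) => v (inl (existT _ i l))].
Proof.
by apply/ffunP=> k; rewrite ffunE eval_act_term.
Qed.

Lemma negligible_value_relations (j : J) : negligible_value (tgt j) =
  act (lcoef j) (negligible_value (src1 j)) +
  act (rcoef j) (negligible_value (src2 j)) +
  act (system (tgt j)) [ffun k => @negligible_witness j k].
Proof.
have /satisfies_relations/(_ j) :=
  @presented_gen_satisfies _ _ (relations negligible_entry negligible_param).
by rewrite !eval_negligible_entry.
Qed.

Lemma ffun_eta (M : lmodType R) n (x : {ffun 'I_n -> M}) : [ffun k => x k] = x.
Proof. by apply/ffunP=> k; rewrite ffunE. Qed.

Lemma family_module_lift (M : lmodType R) (t : kfamily f M)
    (w : forall j : J, 'I_(rows (tgt j)) -> M) :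
    (forall j, t (tgt j) = act (lcoef j) (t (src1 j)) + act (rcoef j) (t (src2 j)) +
                           act (system (tgt j)) [ffun k => w j k]) ->
  exists h : {linear family_module -> M},
    (forall i k, h (@family_var i k) = t i k) /\
    (forall j k, h (@family_witness j k) = w j k).
Proof.
move=> tw; pose v (g : family_generator) : M :=
  match g with inl (existT i k) => t i k | inr (existT j k) => w j k end.
have [|h hP] := @presented_lift _ _ (relations family_entry family_param) _ v.
  by apply/satisfies_relations => j /=; rewrite !ffun_eta.
by exists h; split=> [i k|j k]; apply: hP.
Qed.

Lemma negligible_module_lift (M : lmodType R)
    (y : forall i : I, {ffun 'I_(rows i) -> M})
    (w : forall j : J, 'I_(rows (tgt j)) -> M) :
    (forall j, act (system (tgt j)) (y (tgt j)) =
       act (lcoef j) (act (system (src1 j)) (y (src1 j))) +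
       act (rcoef j) (act (system (src2 j)) (y (src2 j))) +
       act (system (tgt j)) [ffun k => w j k]) ->
  exists h : {linear negligible_module -> M},
    (forall i l, h (@negligible_var i l) = y i l) /\
    (forall j k, h (@negligible_witness j k) = w j k).
Proof.
move=> yw; pose v (g : negligible_generator) : M :=
  match g with inl (existT i l) => y i l | inr (existT j k) => w j k end.
have [|h hP] := @presented_lift _ _ (relations negligible_entry negligible_param) _ v.
  by apply/satisfies_relations => j /=; rewrite !eval_negligible_entry /= !ffun_eta.
by exists h; split=> [i k|j k]; apply: hP.
Qed.

Lemma family_to_negligible_exists :
  exists d : {linear family_module -> negligible_module},
  (forall i k, d (@family_var i k) = negligible_value i k) /\
  (forall j k, d (@family_witness j k) = @negligible_witness j k).
Proof. by apply: family_module_lift => j; apply: negligible_value_relations. Qed.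

Definition family_to_negligible := sval (cid family_to_negligible_exists).

Lemma family_to_negligible_var i :
  vmap family_to_negligible [ffun k => @family_var i k] = negligible_value i.
Proof.
have [dl _] := svalP (cid family_to_negligible_exists).
by apply/ffunP=> k; rewrite -dl !ffunE.
Qed.

Lemma family_to_negligible_witness j k :
  family_to_negligible (@family_witness j k) = @negligible_witness j k.
Proof. by have [_ ->] := svalP (cid family_to_negligible_exists). Qed.

Definition family_of (M : lmodType R) (h : {linear family_module -> M}) : kfamily f M :=
  fun i => vmap h [ffun k => @family_var i k].

Lemma family_of_compatible (M : lmodType R) (h : {linear family_module -> M}) :
  compatible (family_of h).
Proof.
move=> j; exists (vmap h [ffun k => @family_witness j k]).
by rewrite /family_of -!act_vmap -!vmapD family_var_relations.
Qed.

Lemma compatible_family_of (M : lmodType R) (t : kfamily f M) : compatible t ->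
  exists h : {linear family_module -> M}, forall i, family_of h i = t i.
Proof.
move=> tP; have w j := cid (tP j).
have [|h [ht _]] := @family_module_lift M t (fun j k => sval (w j) k).
  by move=> j; rewrite ffun_eta; apply: svalP (w j).
by exists h => i; apply/ffunP=> k; rewrite !ffunE ht.
Qed.

Lemma negligible_family_of (M : lmodType R) (h : {linear family_module -> M}) :
  negligible (family_of h) <->
  exists k : {linear negligible_module -> M}, precomp family_to_negligible k = h.
Proof.
split=> [hN|[k <-] i]; last first.
  exists (vmap k [ffun l => @negligible_var i l]).
  rewrite -act_vmap -[act _ _]family_to_negligible_var.
  by apply/ffunP=> l; rewrite !ffunE.
have y i := cid (hN i).
have [|k [kt kp]] := @negligible_module_lift M (fun i => sval (y i))
  (fun j k => h (@family_witness j k)).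
  move=> j; rewrite !(svalP (y _)) /family_of family_var_relations.
  rewrite !vmapD !act_vmap; congr (_ + act _ _).
  by apply/ffunP=> k; rewrite !ffunE.
exists k; apply: presented_ext => -[[i l]|[j l]]; last first.
  rewrite -[LHS]/(k (family_to_negligible (@family_witness j l))).
  by rewrite family_to_negligible_witness kp.
transitivity (vmap k (vmap family_to_negligible [ffun l => @family_var i l]) l).
  by rewrite !ffunE.
rewrite family_to_negligible_var act_vmap (_ : vmap k _ = sval (y i)).
  by rewrite (svalP (y i)) !ffunE.
by apply/ffunP=> a; rewrite !ffunE kt.
Qed.

End Representation.

(** * The zeroth pure-derived functor *)

(** The Yoneda lemma. *)
Lemma fp_linear_presentation (R : pzRingType) (F : functor R) :
    finitely_presented F ->
  exists (X Y : lmodType R) (f : {linear X -> Y}) (b : nat_trans (hom_functor X) F),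
    forall Z, surj (b Z) /\
      forall h : {linear X -> Z}, b Z h = 0 <-> exists g : {linear Y -> Z}, g \o f =1 h.
Proof.
move=> [X [Y [a [b ab]]]]; exists X, Y, (a Y (id_lin Y)), b => Z.
have [abZ bs] := ab Z; split=> // h; rewrite abZ.
have aE (g : {linear Y -> Z}) : a Z g = comp_lin g (a Y (id_lin Y)).
  rewrite -[RHS](naturality a g (id_lin Y)) /=; congr (a Z _).
  exact: linear_ext.
split=> [[g <-]|[g gh]]; exists g; first by rewrite aE.
by rewrite aE; apply: linear_ext.
Qed.

Lemma fp_iso (R : pzRingType) (F G : functor R) (th : nat_trans F G) :
    (forall M, injective (th M) /\ surj (th M)) ->
  finitely_presented F -> finitely_presented G.
Proof.
move=> thP [X [Y [a [b ab]]]].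
pose c M : {additive hom_functor X M -> G M} :=
  (th M : {additive F M -> G M}) \o (b M : {additive hom_functor X M -> F M}).
have cN (M M' : lmodType R) (g : {linear M -> M'}) :
    c M' \o fmap (hom_functor X) g =1 fmap G g \o c M.
  move=> h; rewrite /= -[RHS](naturality th g (b M h)) /=; congr (th M' _).
  exact: (naturality b g h).
exists X, Y, a, (@NatTrans R (hom_functor X) G c cN).
move=> M; have [abM bs] := ab M; have [ti ts] := thP M; split=> [h|g] /=.
  rewrite -abM; split=> [|->]; last exact: raddf0.
  by move=> t0; apply: ti; rewrite t0 raddf0.
by have [s <-] := ts g; have [h <-] := bs s; exists h.
Qed.

Section Copresentations.
Variables (R : pzRingType) (M U V : lmodType R).
Variables (u : {linear M -> U}) (v : {linear U -> V}).
Hypothesis uv : pi_copresentation u v.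

Lemma copresentation_reflects : reflects_systems u.
Proof. by case: uv => _ _ _ /pure_monoP. Qed.

Lemma copresentation_vu x : v (u x) = 0.
Proof. by case: uv => _ [_ uve] _ _ _; apply/uve; exists x. Qed.

(** Left exactness of M^n/S M^m -> U^n/S U^m -> V^n/S V^m in the middle. *)
Lemma copresentation_solution m n (S : 'M[R^c]_(m, n)) (a : {ffun 'I_n -> U}) w :
  act S w = vmap v a -> exists x z, a = vmap u x + act S z.
Proof.
case: uv => _ _ _ _ [C [p [q [[ui up ps] qp /pure_monoP qS]]]] wa.
have [|c cP] := qS m n S (vmap p a) w.
  by rewrite wa; apply/ffunP=> k; rewrite !ffunE; rewrite -[LHS]qp.
have [z zc] := act_lift c ps.
have /(vmap_exact up)[x xP] : vmap p (a - act S z) = 0.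
  by rewrite vmapB act_vmap zc cP subrr.
by exists x, z; rewrite xP subrK.
Qed.

(** The comparison theorem for injective copresentations: u reflects systems and
    U' is pure-injective, and then the same for the cokernel of u and V'. *)
Lemma copresentation_extend (M' U' V' : lmodType R) (u' : {linear M' -> U'})
    (v' : {linear U' -> V'}) (g : {linear M -> M'}) :
    pi_copresentation u' v' ->
  exists (h : {linear U -> U'}) (k : {linear V -> V'}),
    h \o u =1 u' \o g /\ k \o v =1 v' \o h.
Proof.
move=> [[U'P V'P] [_ uv'] _ _ _]; have uS := copresentation_reflects.
case: uv => _ _ _ _ [C [p [q [[ui up ps] qp /pure_monoP qS]]]].
have [h hP] := (pure_injectiveP U').1 U'P _ _ _ uS (comp_lin u' g).
have [y /up[x <-]|k kP] := @linear_factor R U C V' p (comp_lin v' h) ps.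
  by rewrite /= -[h _]/((h \o u) x) hP; apply/uv'; exists (g x).
have [l lP] := (pure_injectiveP V').1 V'P _ _ _ qS k.
exists h, l; split=> // y /=.
by rewrite -qp -[LHS]/((l \o q) (p y)) lP kP.
Qed.

End Copresentations.

(** Both functors are identified with the same kernels.  Copresentations exist, and
    maps between modules extend to them, so the identification is natural and
    independent of the copresentation. *)
Lemma pure_derived0_iso (R : pzRingType) (F G G' : functor R) :
    is_pure_derived0 F G -> is_pure_derived0 F G' ->
  exists th : nat_trans G G', forall M, injective (th M) /\ surj (th M).
Proof.
move=> [io [ioE ioN]] [io' [io'E io'N]].
have thE M : {th : {additive G M -> G' M} | forall U V u v (c : G M),
    @pi_copresentation R M U V u v -> io' M U V u v (th c) = io M U V u v c}.
  apply: cid; have [U [V [u [v uv]]]] := pi_copresentation_exists M.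
  have [ioi ioe] := ioE _ _ _ _ _ uv; have [io'i io'e] := io'E _ _ _ _ _ uv.
  have [c|c|c d c' d' cd cd'|th thP] := @additive_of_graph (G M) (G' M)
      (fun c c' => io' M U V u v c' = io M U V u v c).
  - have /io'e[c' <-] : fmap F v (io M U V u v c) = 0 by apply/ioe; exists c.
    by exists c'.
  - by rewrite raddf0 => io'0; apply: io'i; rewrite io'0 raddf0.
  - by rewrite !raddfB cd cd'.
  exists th => U' V' u' v' c uv'.
  have [h [k [hu kv]]] := copresentation_extend uv (id_lin M) uv'.
  have := io'N _ _ _ _ _ _ _ _ _ _ _ _ _ uv uv' hu kv (th c).
  have := ioN _ _ _ _ _ _ _ _ _ _ _ _ _ uv uv' hu kv c.
  by rewrite /= !fmap_id thP => -> ->.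
have thN (M M' : lmodType R) (g : {linear M -> M'}) :
    sval (thE M') \o fmap G g =1 fmap G' g \o sval (thE M).
  move=> c; have [U [V [u [v uv]]]] := pi_copresentation_exists M.
  have [U' [V' [u' [v' uv']]]] := pi_copresentation_exists M'.
  have [h [k [hu kv]]] := copresentation_extend uv g uv'.
  have [io'i _] := io'E _ _ _ _ _ uv'; apply: io'i.
  rewrite /= (svalP (thE M')) //.
  have := io'N _ _ _ _ _ _ _ _ _ _ _ _ _ uv uv' hu kv (sval (thE M) c).
  have := ioN _ _ _ _ _ _ _ _ _ _ _ _ _ uv uv' hu kv c.
  by rewrite /= (svalP (thE M)) // => -> ->.
exists (NatTrans thN) => M /=.
have [U [V [u [v uv]]]] := pi_copresentation_exists M.
have [ioi ioe] := ioE _ _ _ _ _ uv; have [io'i io'e] := io'E _ _ _ _ _ uv.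
split=> [c d cd|c'].
  by apply: ioi; rewrite -!(svalP (thE M)) // cd.
have /ioe[c cP] : fmap F v (io' M U V u v c') = 0 by apply/io'e; exists c'.
by exists c; apply: io'i; rewrite (svalP (thE M)).
Qed.

Lemma sub_sub_rearrange (W : zmodType) (p q a c d e : W) :
  a - e + (c + d) = p + q + a - e - ((p - c) + (q - d)).
Proof.
rewrite [p - c + _]addrACA -opprD opprB [RHS]addrA.
by apply/eqP; rewrite eq_sym subr_eq [X in _ == X]addrC !addrA.
Qed.

Lemma act_sub (R : pzRingType) (M : lmodType R) m n m' n' (S : 'M[R^c]_(m, n))
    (S' : 'M[R^c]_(m', n')) (B : 'M[R^c]_(n, n')) (C : 'M[R^c]_(m, m'))
    (a : {ffun 'I_n -> M}) (z : {ffun 'I_m -> M}) :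
  S *m B = C *m S' -> act B (a - act S z) = act B a - act S' (act C z).
Proof. by move=> BC; rewrite actB !act_mul BC. Qed.

Section PureDerivedFunctor.
Variables (R : pzRingType) (F : functor R) (X Y : lmodType R) (f : {linear X -> Y}).
Variable b : nat_trans (hom_functor X) F.
Hypothesis b_surj : forall Z, surj (b Z).
Hypothesis b_kernel : forall (Z : lmodType R) (h : {linear X -> Z}),
  b Z h = 0 <-> exists g : {linear Y -> Z}, g \o f =1 h.

Local Notation G := (coker_functor (family_to_negligible f)).
Local Notation cl := (coker_class (family_to_negligible f)).

Lemma coker_class_eq0 (M : lmodType R) (t : {linear family_module f -> M}) :
  cl M t = 0 <-> negligible (family_of t).
Proof.
rewrite negligible_family_of.
exact: (coker_exact (precomp_add (family_to_negligible f) M)).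
Qed.

Lemma family_ofB (M : lmodType R) (s t : {linear family_module f -> M}) i :
  family_of (s - t) i = family_of s i - family_of t i.
Proof. by apply/ffunP=> k; rewrite !ffunE. Qed.

Lemma family_of_comp (M M' : lmodType R) (g : {linear M -> M'})
    (t : {linear family_module f -> M}) i :
  family_of (comp_lin g t) i = vmap g (family_of t i).
Proof. by apply/ffunP=> k; rewrite !ffunE. Qed.

(** F U -> Nat(K, - (x) U) is injective for U pure-injective. *)
Lemma presentation_eq0 (U : lmodType R) (h : {linear X -> U}) : pure_injective U ->
  b U h = 0 <-> negligible (fun i : kpoint f => vmap h (kvec i)).
Proof.
move=> UP; rewrite b_kernel; split=> [[g gf] i|hN].
  have [y yP] := kvecP i; exists (vmap g y); rewrite -act_vmap yP.
  by apply/ffunP=> k; rewrite !ffunE; apply: gf.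
exact: kernel_point_factor.
Qed.

(** The image of c in Nat(K, - (x) U) is the image of s under
    F U -> Nat(K, - (x) U), an isomorphism if U is pure-injective. *)
Definition realizes (M U : lmodType R) (u : {linear M -> U}) (c : G M) (s : F U) :=
  exists (t : {linear family_module f -> M}) (h : {linear X -> U}),
    [/\ cl M t = c, b U h = s &
        negligible (fun i => vmap h (kvec i) - vmap u (family_of t i))].

Lemma realizesB (M U : lmodType R) (u : {linear M -> U}) c s c' s' :
  realizes u c s -> realizes u c' s' -> realizes u (c - c') (s - s').
Proof.
move=> [t [h [<- <- th]]] [t' [h' [<- <- th']]]; exists (t - t'), (h - h').
rewrite !raddfB; split=> // i; have [[w wi] [w' w'i]] := (th i, th' i).
exists (w - w'); rewrite actB wi w'i family_ofB vmapB.
have -> : vmap (h - h') (kvec i) = vmap h (kvec i) - vmap h' (kvec i).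
  by apply/ffunP=> k; rewrite !ffunE.
by rewrite !opprD !opprK addrACA.
Qed.

Lemma realizes_total (M U : lmodType R) (u : {linear M -> U}) c :
  pure_injective U -> exists s, realizes u c s.
Proof.
move=> UP; have [t <-] := coker_class_surj c.
have [h hP] := family_extend UP (compatible_map u (family_of_compatible t)).
by exists (b U h), t, h.
Qed.

Lemma realizes0 (M U : lmodType R) (u : {linear M -> U}) s :
  pure_injective U -> realizes u 0 s -> s = 0.
Proof.
move=> UP [t [h [/coker_class_eq0 tN <- th]]]; apply/presentation_eq0 => // i.
have [[w wi] [w' w'i]] := (th i, tN i).
by exists (w + vmap u w'); rewrite actD -act_vmap wi w'i subrK.
Qed.

Lemma realizes_inj (M U : lmodType R) (u : {linear M -> U}) c :
  pure_injective U -> reflects_systems u -> realizes u c 0 -> c = 0.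
Proof.
move=> UP uS [t [h [<- /(presentation_eq0 _ UP) hN th]]]; apply/coker_class_eq0 => i.
have [[w wi] [w' w'i]] := (th i, hN i).
apply: (uS _ _ _ _ (w' - w)); rewrite actB wi w'i.
by rewrite opprB addrC subrK.
Qed.

Lemma realizes_fmap (M U M' U' : lmodType R) (u : {linear M -> U})
    (u' : {linear M' -> U'}) (g : {linear M -> M'}) (k : {linear U -> U'}) c s :
  k \o u =1 u' \o g -> realizes u c s -> realizes u' (fmap G g c) (fmap F k s).
Proof.
move=> ku [t [h [<- <- th]]]; exists (comp_lin g t), (comp_lin k h); split.
- by rewrite -[RHS]/(coker_fmap_fun g _) coker_fmap_class.
- exact: (naturality b k h).
move=> i; have [w wi] := th i; exists (vmap k w).
rewrite -act_vmap wi vmapB family_of_comp; congr (_ - _).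
  by apply/ffunP=> l; rewrite !ffunE.
by apply/ffunP=> l; rewrite !ffunE; apply: ku.
Qed.

(** If s is the class of h : X -> U and F v s = 0, then v o h is negligible, so
    every h x_i is u m_i modulo the system, for some m_i over M.  The family m
    is compatible because u reflects systems, and it represents c. *)
Lemma realizes_kernel (M U V : lmodType R) (u : {linear M -> U})
    (v : {linear U -> V}) s :
  pi_copresentation u v -> fmap F v s = 0 <-> exists c, realizes u c s.
Proof.
move=> uv; have [[UP VP] _ _ _ _] := uv; have uS := copresentation_reflects uv.
split=> [|[c [t [h [_ <- th]]]]]; last first.
  rewrite -[fmap F v _](naturality b v h); apply/presentation_eq0 => // i.
  have [w wi] := th i; exists (vmap v w); rewrite -act_vmap wi vmapB.
  by apply/ffunP=> k; rewrite !ffunE (copresentation_vu uv) subr0.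
have [h <-] := b_surj s; rewrite -[fmap F v _](naturality b v h).
move=> /presentation_eq0 hN.
have sol (i : kpoint f) : exists x z,
    vmap h (kvec i) = vmap u x + act (system i) z.
  have [w wi] := hN VP i; apply: (copresentation_solution uv (w := w)).
  by rewrite wi; apply/ffunP=> k; rewrite !ffunE.
pose x i := sval (cid (sol i)); pose z i := sval (cid (svalP (cid (sol i)))).
have xE i : vmap u (x i) = vmap h (kvec i) - act (system i) (z i).
  by rewrite (svalP (cid (svalP (cid (sol i))))) addrK.
have xP : compatible x.
  move=> j.
  have [[C1 C1E] [C2 C2E]] := (lcoefP j, rcoefP j); have [w wE] := krelationP j.
  set E := act (lcoef j) (x (src1 j)) + act (rcoef j) (x (src2 j)).
  have [|y yP] := uS _ _ (system (tgt j)) (x (tgt j) - E)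
    (vmap h w - z (tgt j) + (act C1 (z (src1 j)) + act C2 (z (src2 j)))).
    rewrite /E vmapB vmapD !act_vmap !xE (act_sub _ _ C1E) (act_sub _ _ C2E).
    rewrite wE !vmapD !act_vmap.
    move: (vmap h w) (vmap h (kvec (src1 j))) (vmap h (kvec (src2 j))) => a p q.
    move: (act C1 _) (act C2 _) (z _) => c d e; rewrite actD actB actD.
    exact: (@sub_sub_rearrange {ffun 'I_(cols (tgt j)) -> U}).
  by exists y; rewrite yP addrC subrK.
have [t tP] := compatible_family_of xP.
exists (cl M t), t, h; split=> // i; exists (z i).
by rewrite tP xE opprB addrC subrK.
Qed.

(** The map G M -> F U sends c to the only s with which it is related by realizes. *)
Lemma pure_derived0_coker : is_pure_derived0 F G.
Proof.
have ioE (M U V : lmodType R) (u : {linear M -> U}) (v : {linear U -> V}) :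
    {io : {additive G M -> F U} | pi_copresentation u v ->
      forall c, realizes u c (io c)}.
  apply: cid; have [uv|nuv] := pselect (pi_copresentation u v); last by exists \0.
  have [[UP VP] _ _ _ _] := uv.
  have [c|s|c s c' s'|io ioP] := @additive_of_graph (G M) (F U) (realizes u).
  - exact: realizes_total.
  - exact: realizes0.
  - exact: realizesB.
  by exists io.
exists (fun M U V u v => sval (ioE M U V u v)); split.
  move=> M U V u v uv; have [[UP VP] _ _ _ _] := uv.
  have ioP := svalP (ioE M U V u v) uv.
  split=> [|s].
    apply: raddf_inj => c io0; apply: (realizes_inj UP (copresentation_reflects uv)).
    by rewrite -io0; apply: ioP.
  rewrite (realizes_kernel _ uv); split=> [[c cs]|[c <-]]; last by exists c.
  exists c; apply/subr0_eq/(realizes0 UP (u := u)).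
  by rewrite -(subrr c); apply: realizesB.
move=> M U V M' U' V' u v u' v' g h k uv uv' hu kv c /=.
have [[U'P V'P] _ _ _ _] := uv'.
apply/subr0_eq/(realizes0 U'P (u := u')); rewrite -(subrr (fmap G g c)).
apply: realizesB; first exact: (svalP (ioE _ _ _ _ _)).
by apply: realizes_fmap hu _; apply: (svalP (ioE _ _ _ _ _)).
Qed.

End PureDerivedFunctor.

Theorem mainTheorem4 (R : pzRingType) (F : functor R) :
  finitely_presented F ->
  (exists G : functor R, is_pure_derived0 F G) /\
  (forall G : functor R, is_pure_derived0 F G -> finitely_presented G).
Proof.
move=> /fp_linear_presentation[X [Y [f [b bP]]]].
have D : is_pure_derived0 F (coker_functor (family_to_negligible f)).
  apply: (@pure_derived0_coker R F X Y f b) => [Z|Z h].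
    by have [] := bP Z.
  by have [_] := bP Z; apply.
split=> [|G DG]; first by exists (coker_functor (family_to_negligible f)).
have [th thP] := pure_derived0_iso D DG.
exact: fp_iso thP (coker_functor_fp _).
Qed.
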